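(* Let $(M,g)$ be a closed Riemannian manifold. There exists a constant $C_5>0$, depending only on $(M,g)$, such that for every domain $\Omega\subseteq M$, $$\lambda_1(\Omega)\ \leq\ \frac{C_5}{\mathrm{inrad}(\Omega)^2}.$$
   Context: ''Closed'' means compact without boundary. A domain is a nonempty connected open subset. $\lambda_1(\Omega)$ denotes the first Dirichlet eigenvalue of the Laplace--Beltrami operator on $\Omega$, i.e. $\lambda_1(\Omega)=\inf\left\{\int_\Omega|\nabla u|^2\,d\mathrm{vol}\big/\int_\Omega|u|^2\,d\mathrm{vol} : u\in C_c^\infty(\Omega),\ u\not\equiv 0\right\}$. $\mathrm{inrad}(\Omega)$ denotes the inner radius of $\Omega$: the supremum of all $r>0$ such that some metric (geodesic) ball of radius $r$ in $M$ is contained in $\Omega$ (with the convention $C/\infty=0$; in the degenerate case where this supremum is infinite, e.g. $\Omega=M$, one has $\lambda_1(\Omega)=0$). *)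

(* Defs.v *)
From HB Require Import structures.
From mathcomp Require Import all_boot all_order all_algebra.
From mathcomp Require Import all_classical all_reals all_analysis.

Set Implicit Arguments.
Unset Strict Implicit.
Unset Printing Implicit Defensive.

Import Order.TTheory GRing.Theory Num.Theory.
Import numFieldNormedType.Exports.

Local Open Scope classical_set_scope.
Local Open Scope ring_scope.

(* Lebesgue measure on R^n for the product (= Borel) sigma-algebra of
   [n.-tuple R], as an iterated product of the measure on the line.  Tuples are
   used because the library puts a sigma-algebra on them and not on 'rV[R]_n. *)
Fixpoint lebesgue_tuple (R : realType) (n : nat) :
    set (n.-tuple (measurableTypeR R)) -> \bar R :=
  match n with
  | 0 => \d_([tuple] : 0.-tuple (measurableTypeR R))
  | n'.+1 => pushforward (lebesgue_measure \x lebesgue_tuple (n := n'))%E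
               (fun xt : measurableTypeR R * n'.-tuple (measurableTypeR R) =>
                  [tuple of xt.1 :: xt.2])
  end.

Definition row_of_tuple (R : Type) (n : nat) (t : n.-tuple R) : 'rV[R]_n :=
  \row_j tnth t j.

(* f is C^oo on the open set V: every iterated directional derivative is
   (Frechet) differentiable at every point of V.  Only the germs of f at the
   points of V matter. *)
Definition smooth_on (R : realType) (n : nat) (W : normedModType R)
    (V : set 'rV[R]_n) (f : 'rV[R]_n -> W) : Prop :=
  forall (vs : seq 'rV[R]_n) (y : 'rV[R]_n), V y ->
    differentiable (foldr (fun v h z => 'D_v h z) f vs) y.

(* A smooth n-manifold without boundary, given by an atlas, with a smooth
   Riemannian metric.  [chart i] and [param i] are mutually inverse between
   [cdom i] (open in M) and its image (open in R^n); both are total functions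
   whose values elsewhere are irrelevant.  Tangent vectors are row vectors of
   components in a chart, the matrix of the metric acts on them by
   g(v, w) = v *m G *m w^T, and the library's Jacobian 'J is also for row
   vectors (the differential is v |-> v *m 'J), whence the form of
   [metric_change]. *)
Record riemannian_manifold (R : realType) (n : nat) (M : topologicalType) :=
  RiemannianManifold {
  chart_index : Type;
  cdom : chart_index -> set M;
  chart : chart_index -> M -> 'rV[R]_n;
  param : chart_index -> 'rV[R]_n -> M;
  metric : chart_index -> 'rV[R]_n -> 'M[R]_n;
  manifold_hausdorff : hausdorff_space M;
  manifold_second_countable : @second_countable M;
  cdom_open : forall i, open (cdom i);
  cdom_cover : forall x, exists i, cdom i x;
  cimage_open : forall i, open (chart i @` cdom i);
  chartK : forall i x, cdom i x -> param i (chart i x) = x;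
  chart_continuous : forall i x, cdom i x -> {for x, continuous (chart i)};
  param_continuous : forall i y, (chart i @` cdom i) y ->
    {for y, continuous (param i)};
  transition_smooth : forall i j,
    smooth_on (chart i @` (cdom i `&` cdom j)) (chart j \o param i);
  metric_smooth : forall i k l,
    smooth_on (chart i @` cdom i) (fun y => metric i y k l : R);
  metric_sym : forall i y, (chart i @` cdom i) y ->
    (metric i y)^T = metric i y;
  metric_pos : forall i y, (chart i @` cdom i) y ->
    forall v : 'rV[R]_n, v != 0 -> 0 < (v *m metric i y *m v^T) 0 0;
  metric_change : forall i j x, cdom i x -> cdom j x ->
    let J := 'J (chart j \o param i) (chart i x) in
    metric i (chart i x) = J *m metric j (chart j x) *m J^T
}.

Notation borel M := (g_sigma_algebraType (@open M)).

Section RiemannianNotions.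
Context (R : realType) (n : nat) (M : ptopologicalType).
Variable g : riemannian_manifold R n M.

(* These equations determine mu uniquely, and such a mu exists by the change
   of variables formula: it is the Riemannian volume measure. *)
Definition is_riemannian_volume (mu : {measure set (borel M) -> \bar R}) : Prop :=
  forall (i : chart_index g) (A : set (borel M)), measurable A -> A `<=` cdom i ->
    mu A = (\int[@lebesgue_tuple R n]_(t in @row_of_tuple R n @^-1` (chart i @` A))
              (Num.sqrt (\det (metric i (row_of_tuple t))))%:E)%E.

Definition sqnorm (i : chart_index g) (y v : 'rV[R]_n) : R :=
  (v *m metric i y *m v^T) 0 0.

(* A chart around x; the objects defined from it do not depend on the choice. *)
Definition chart_at (x : M) : chart_index g := sval (cid (cdom_cover g x)).

(* Components g^{kl} d_l u of the gradient in the chart [chart_at x]. *)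
Definition gradient (u : M -> R) (x : M) : 'rV[R]_n :=
  let i := chart_at x in
  let du : 'rV[R]_n := \row_j 'D_(delta_mx 0 j) (u \o param i) (chart i x) in
  du *m invmx (metric i (chart i x)).

Definition gradient_sqnorm (u : M -> R) (x : M) : R :=
  sqnorm (chart_at x) (chart (chart_at x) x) (gradient u x).

Definition smooth_fun (u : M -> R) : Prop :=
  forall i : chart_index g, smooth_on (chart i @` cdom i) (u \o param i).

Definition test_function (Omega : set M) (u : M -> R) : Prop :=
  [/\ smooth_fun u, compact (closure [set x | u x != 0]) &
      closure [set x | u x != 0] `<=` Omega].

Definition lambda1 (mu : {measure set (borel M) -> \bar R}) (Omega : set M) :
    \bar R :=
  ereal_inf [set ((\int[mu]_(x in Omega) (gradient_sqnorm u x)%:E) /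
                  (\int[mu]_(x in Omega) (`|u x| ^+ 2)%:E))%E |
             u in [set u | test_function Omega u /\ exists x, u x != 0]].

(* A piecewise C^1 curve is a finite concatenation of arcs, an arc being a C^1
   curve [0, 1] -> M contained in a chart domain, read in that chart. (Every
   piecewise C^1 curve can be so subdivided; a C^1 function on [0, 1] is one
   that extends to a C^1 function around [0, 1].) *)
Definition C1_arc : Type := (chart_index g * (R -> 'rV[R]_n))%type.

Definition is_arc (a : C1_arc) : Prop :=
  [/\ forall t, t \in `[0, 1] -> (chart a.1 @` cdom a.1) (a.2 t),
      forall t, t \in `[0, 1] -> derivable a.2 t 1 &
      {within `[0, 1], continuous (derive1 a.2)}].

Definition arc_length (a : C1_arc) : \bar R :=
  (\int[lebesgue_measure]_(t in `[0%R, 1%R])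
     (Num.sqrt (sqnorm a.1 (a.2 t) (derive1 a.2 t)))%:E)%E.

Fixpoint curve_from_to (x : M) (c : seq C1_arc) (y : M) : Prop :=
  match c with
  | [::] => x = y
  | a :: c' => [/\ is_arc a, param a.1 (a.2 0) = x &
                   curve_from_to (param a.1 (a.2 1)) c' y]
  end.

Definition curve_length (c : seq C1_arc) : \bar R :=
  (\sum_(a <- c) arc_length a)%E.

(* +oo when x and y lie in different components *)
Definition geodesic_dist (x y : M) : \bar R :=
  ereal_inf [set curve_length c | c in [set c | curve_from_to x c y]].

Definition geodesic_ball (x : M) (r : R) : set M :=
  [set y | (geodesic_dist x y < r%:E)%E].

Definition inrad (Omega : set M) : \bar R :=
  ereal_sup [set r%:E | r in
    [set r : R | 0 < r /\ exists x, geodesic_ball x r `<=` Omega]].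

End RiemannianNotions.

Definition domain (M : topologicalType) (Omega : set M) : Prop :=
  [/\ open Omega, connected Omega & Omega !=set0].

(* Main.v *)
(* Around each point there is a chart in which the metric is comparable to the
   Euclidean one on a cube of definite size, with constants that are uniform by
   compactness.  If a geodesic ball of radius r lies in Omega and r is small, then
   Omega contains a coordinate cube of size comparable to r; transplanting a bump
   function of that size to M gives a test function u with |grad u| <= L / r, and
   comparing the volumes of two concentric cubes bounds its Rayleigh quotient by a
   constant over r ^ 2.

   Large radii: by compactness, points at finite geodesic distance are at distance
   less than some D.  If Omega contains a geodesic ball of radius D, that ball is
   open and closed, hence equal to Omega, and the constant function 1 on Omega shows
   that lambda1 <= 0.  Otherwise inrad <= D, and large radii reduce to small ones.

   inrad is a supremum in the extended reals, so it must be shown that Omega contains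
   some geodesic ball: a curve leaving the support of the bump function u above has
   length at least u (start) / sup |grad u|. *)
Require Import Defs.
From HB Require Import structures.
From mathcomp Require Import all_boot all_order all_algebra.
From mathcomp Require Import all_classical all_reals all_analysis.
From mathcomp Require Import ring lra.

Import Order.TTheory GRing.Theory Num.Theory.
Import numFieldNormedType.Exports.

Local Open Scope classical_set_scope.
Local Open Scope ring_scope.

(** * Lebesgue measure on tuples as a sigma-finite measure, and volumes of cubes *)

Section SigmaFinitePack.
Context {d} {T : measurableType d} {R : realType}.
Context {m : {measure set T -> \bar R}}.

(* The dummy argument lets unification recover the proof of sigma-finiteness. *)
Definition sigma_finite_copy (_ : sigma_finite setT m) : set T -> \bar R := m.

Variable sf : sigma_finite setT m.

HB.instance Definition _ := Measure.copy (sigma_finite_copy sf) m.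

HB.instance Definition _ :=
  Measure_isSigmaFinite.Build _ _ _ (sigma_finite_copy sf) sf.

End SigmaFinitePack.

Section Measure.
Set Implicit Arguments.
Unset Strict Implicit.
Context {R : realType}.

(** The integral of a nonnegative function is the supremum of the integrals of the simple functions
    below it, and this supremum grows with the function. It serves for integrands such as
    [gradient_sqnorm], which is defined through a choice of charts. *)
Lemma ge0_le_integral_nonmeasurable d (T : measurableType d)
    (mu : {measure set T -> \bar R}) (D : set T) (f f' : T -> \bar R) :
  (forall x, D x -> 0 <= f x)%E -> (forall x, D x -> f x <= f' x)%E ->
  (\int[mu]_(x in D) f x <= \int[mu]_(x in D) f' x)%E.
Proof.
move=> f0 ff'; rewrite !ge0_integralE//; last first.
  by move=> x Dx; apply: le_trans (ff' _ Dx); exact: f0.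
apply: ge_ereal_sup => /= _ [h /= hf <-]; apply: ereal_sup_ubound => /=.
exists h => //= x; apply: le_trans (hf x) _.
by rewrite !patchE; case: ifPn => //; rewrite inE; exact: ff'.
Qed.

Lemma pushforward_measure_pack d d' (T : measurableType d) (T' : measurableType d')
    (m : {measure set T -> \bar R}) (f : T -> T') : measurable_fun setT f ->
  exists m' : {measure set T' -> \bar R}, pushforward m f = m'.
Proof.
move=> mf; unshelve eexists; first exact: (pushforward m f).
all: by [].
Qed.

Lemma product_sigma_finite_measure d1 d2 (T1 : measurableType d1)
    (T2 : measurableType d2) (m1 : {sigma_finite_measure set T1 -> \bar R})
    (m2 : {sigma_finite_measure set T2 -> \bar R}) :
  exists m : {sigma_finite_measure set (T1 * T2)%type -> \bar R}, (m1 \x m2)%E = m.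
Proof.
suff sf : sigma_finite setT (m1 \x m2)%E by exists (sigma_finite_copy sf).
have /sigma_finiteP[F [TF ndF Foo]] := sigma_finiteT m1.
have /sigma_finiteP[G [TG ndG Goo]] := sigma_finiteT m2.
(* Both exhaustions are increasing, so a pair lies in the rectangle whose index is the larger of the
   two indices. *)
exists (fun k => F k `*` G k) => [|k].
  apply/seteqP; split => // -[x y] _.
  have [k _ Fkx] : (\bigcup_k F k) x by rewrite -TF.
  have [l _ Gly] : (\bigcup_k G k) y by rewrite -TG.
  exists (maxn k l) => //; split => /=.
  - exact: subsetPset (ndF _ _ (leq_maxl k l)) _ Fkx.
  - exact: subsetPset (ndG _ _ (leq_maxr k l)) _ Gly.
have [? ?] := Foo k; have [? ?] := Goo k.
split; first exact: measurableX.
by rewrite product_measure1E// lte_mul_pinfty// ge0_fin_numE.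
Qed.

(** [lebesgue_tuple] is a bare set function; integrals and products of measures ask for a packed
    one. In the induction step, head and tail give a measurable inverse of the cons map, and the
    exhaustion of the product is pulled back along it. *)
Lemma lebesgue_tuple_sigma_finite (n : nat) :
  exists m : {sigma_finite_measure set (n.-tuple (measurableTypeR R)) -> \bar R},
    @lebesgue_tuple R n = m.
Proof.
elim: n => [|n [m mE]]; first by exists \d_([tuple] : 0.-tuple (measurableTypeR R)).
pose f (xt : measurableTypeR R * n.-tuple (measurableTypeR R)) :=
  [tuple of xt.1 :: xt.2].
have mf : measurable_fun setT f by exact: measurable_cons.
have mth : measurable_fun [set: n.+1.-tuple (measurableTypeR R)]
  (fun t => tnth t ord0) by exact: measurable_tnth.
have mbeh : measurable_fun [set: n.+1.-tuple (measurableTypeR R)]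
  (fun t => [tuple of behead t]) by exact: measurable_behead.
have gf xt : (tnth (f xt) ord0, [tuple of behead (f xt)]) = xt.
  by case: xt => x t; congr pair => //; exact: val_inj.
have [m12 m12E] := product_sigma_finite_measure lebesgue_measure m.
have [p pE] := pushforward_measure_pack m12 mf.
have sf : sigma_finite setT p.
  have [F TF Foo] := sigma_finiteT m12.
  exists (fun k => (fun t => (tnth t ord0, [tuple of behead t])) @^-1` F k).
    apply/seteqP; split => // t _.
    have : (setT : set (measurableTypeR R * n.-tuple (measurableTypeR R)))
      (tnth t ord0, [tuple of behead t]) by [].
    by rewrite TF => -[k kT Fk]; exists k.
  move=> k; have [mFk Fk] := Foo k; split.
    have mg : measurable_fun [set: n.+1.-tuple (measurableTypeR R)]
      (fun t => (tnth t ord0, [tuple of behead t])) by exact: measurable_fun_pair.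
    by rewrite -[X in measurable X]setTI; exact: mg.
  rewrite -pE /pushforward (_ : f @^-1` _ = F k)//.
  by apply/funext => xt; rewrite /preimage/= gf.
exists (sigma_finite_copy sf). 
by rewrite /= mE [X in pushforward X]m12E pE.
Qed.

Lemma measurable_cube (n : nat) (c : 'I_n -> R) (rho : R) :
  measurable [set t : n.-tuple (measurableTypeR R) |
    forall j, `|tnth t j - c j| < rho].
Proof.
rewrite [X in measurable X](_ : _ = \bigcap_(j in [set: 'I_n])
  ((fun t : n.-tuple (measurableTypeR R) => tnth t j) @^-1`
    [set` `]c j - rho, c j + rho[])).
  apply: fin_bigcap_measurable => // j _; rewrite -[X in measurable X]setTI.
  exact: measurable_tnth.
apply/seteqP; split => t /=.
  by move=> + j _ => /(_ j); rewrite /= in_itv/= -ltr_distlC distrC.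
by move=> + j => /(_ j Logic.I); rewrite /= in_itv/= -ltr_distlC distrC.
Qed.

Lemma lebesgue_tuple_cube (n : nat) (c : 'I_n -> R) (rho : R) : 0 <= rho ->
  @lebesgue_tuple R n [set t | forall j, `|tnth t j - c j| < rho]
  = ((2 * rho) ^+ n)%:E.
Proof.
move=> rho0; elim: n c => [|n IH] c.
  by rewrite /= diracE mem_set// => -[].
have [m mE] := lebesgue_tuple_sigma_finite n.
rewrite /= /pushforward.
rewrite (_ : _ @^-1` _ = [set` `]c ord0 - rho, c ord0 + rho[] `*`
    [set t : n.-tuple (measurableTypeR R) |
      forall j, `|tnth t j - c (lift ord0 j)| < rho]).
  rewrite mE product_measure1E//; last exact: measurable_cube.
  rewrite -mE IH exprS EFinM; congr (_ * _)%E.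
  have := lebesgue_measure_itv `]c ord0 - rho, c ord0 + rho[; rewrite /= => ->.
  (* If the interval is empty then [rho = 0], and both sides vanish. *)
  rewrite lte_fin; case: ifPn => [_|]; first by rewrite -EFinD; congr EFin; ring.
  by rewrite -leNgt => h; congr EFin; lra.
apply/seteqP; split => -[x t] /=.
  move=> h; split.
    by have := h ord0; rewrite in_itv/= -ltr_distlC distrC.
  by move=> j; have := h (lift ord0 j); rewrite tnthS.
move=> [+ h] j; rewrite in_itv/= -ltr_distlC distrC => hx.
case: (unliftP ord0 j) => [k ->|->//]; first by rewrite tnthS.
Qed.
End Measure.

(** * The flat function [exp (- 1 / x)] and its derivatives *)

Section FlatBump.
Context {R : realType}.
Set Implicit Arguments.
Unset Strict Implicit.
Implicit Types (p : {poly R}) (x s : R).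

(** Induction on the degree: half of the exponential absorbs one factor [s], since
    [s * expR (- (eps / 2 * s)) <= 2 / eps], and the other half is left for the induction
    hypothesis. *)
Lemma poly_expR_bounded p (eps : R) : 0 < eps ->
  exists2 C : R, 0 <= C & forall s, 0 <= s -> `|p.[s]| * expR (- (eps * s)) <= C.
Proof.
elim/poly_ind: p eps => [|p c IH] eps eps0.
  by exists 0 => // s _; rewrite horner0 normr0 mul0r.
have eps2 : 0 < eps / 2 by rewrite divr_gt0.
have [C C0 hC] := IH _ eps2.
exists (C * (2 / eps) + `|c|); first by apply: addr_ge0 => //; apply: mulr_ge0 => //;
  apply: divr_ge0 => //; exact: ltW.
move=> s s0; rewrite hornerMXaddC.
have e1 : expR (- (eps * s)) <= 1 by rewrite expR_le1 oppr_le0 mulr_ge0// ltW.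
have se : s * expR (- (eps / 2 * s)) <= 2 / eps.
  rewrite expRN ler_pdivrMr ?expR_gt0//.
  apply: (@le_trans _ _ (2 / eps * (eps / 2 * s))).
    by rewrite mulrA [X in X * s](_ : _ = 1) ?mul1r//; field; rewrite gt_eqF.
  rewrite ler_pM2l ?divr_gt0//; apply: le_trans (expR_ge1Dx _).
  by rewrite lerDr.
apply: (@le_trans _ _ ((`|p.[s]| * s + `|c|) * expR (- (eps * s)))).
  apply: ler_wpM2r; first exact: expR_ge0.
  by rewrite (le_trans (ler_normD _ _))// normrM (ger0_norm s0).
rewrite mulrDl lerD//; last by rewrite ler_piMr.
rewrite (_ : - (eps * s) = - (eps / 2 * s) + - (eps / 2 * s)); last by field.
rewrite expRD mulrACA ler_pM ?mulr_ge0 ?expR_ge0//; exact: hC.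
Qed.

(* [flat 1] is the flat function [exp (- 1 / x)]; the family is closed under
   differentiation. *)
Definition flat p x : R := if 0 < x then p.[x^-1] * expR (- x^-1) else 0.

Lemma flat_le0 p x : x <= 0 -> flat p x = 0.
Proof. by rewrite /flat ltNge => ->. Qed.

Lemma flat_bounded p : exists2 C : R, 0 < C & forall x, `|flat p x| <= C.
Proof.
have [C C0 hC] := @poly_expR_bounded p 1 ltr01.
exists (C + 1) => [|x]; first by rewrite ltr_wpDl.
apply: (@le_trans _ _ C); last by rewrite lerDl.
rewrite /flat; case: ifPn => [x0|_]; last by rewrite normr0.
rewrite normrM (ger0_norm (expR_ge0 _)).
by have := hC x^-1; rewrite mul1r; apply; rewrite invr_ge0 ltW.
Qed.

(** The indeterminate stands for [x^-1], so each ['X] is worth a factor [x]. As the last factor is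
    bounded, [flat p] vanishes at 0 to every order. *)
Lemma flatMXn p k x : 0 <= x -> flat p x = x ^+ k * flat (p * 'X^k) x.
Proof.
rewrite /flat le_eqVlt => /predU1P[<-|x0]; first by rewrite ltxx mulr0.
have xk : x ^+ k != 0 by rewrite expf_neq0// gt_eqF.
by rewrite x0 hornerM hornerXn exprVn; move: (x ^+ k) xk => a a0; field.
Qed.

Lemma is_derive_flat p x :
  is_derive x 1 (flat p) (flat ((p - p^`()) * 'X^2) x).
Proof.
have [x0|x0|->] := ltgtP x 0.
- rewrite (flat_le0 _ (ltW x0)).
  apply: (@near_eq_is_derive _ _ _ (cst 0)).
    near=> y; rewrite flat_le0//; near: y.
    by apply: filterS (lt_nbhsl x0) => y /ltW.
- rewrite /flat x0.
  pose f := fun y : R => p.[y^-1] * expR (- y^-1).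
  apply: (@near_eq_is_derive _ _ _ f).
    near=> y; rewrite ifT//; near: y; exact: lt_nbhsr.
  have xn0 : x != 0 by rewrite gt_eqF.
  have dV : is_derive x 1 (fun y : R => y^-1) (- x ^- 2).
    have -> : - x ^- 2 = - x ^- 2 *: (1:R) by rewrite /GRing.scale/= mulr1.
    exact: is_deriveV.
  have dp : is_derive x 1 (horner p \o (fun y : R => y^-1)) (p^`().[x^-1] * - x ^- 2).
    have dh : is_derive x^-1 1 (horner p) p^`().[x^-1].
      apply: DeriveDef; first exact: derivable_horner.
      by rewrite -derive1E -derivE.
    exact: is_derive1_comp.
  have de : is_derive x 1 (expR \o (fun y : R => - y^-1)) (expR (- x^-1) * x ^- 2).
    apply: is_derive1_comp.
    by have := is_deriveN dV; rewrite opprK.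
  have dM := is_deriveM dp de.
  have -> : f = (horner p \o (fun y : R => y^-1)) * (expR \o (fun y : R => - y^-1)).
    by [].
  apply: (is_derive_eq dM).
  rewrite /GRing.scale/= hornerM hornerD hornerN hornerXn; field; exact: xn0.
(* At 0, the bound [C * h ^ 2] on [flat p h] makes the difference quotient tend to 0. *)
- rewrite flat_le0//.
  have [C C0 hC] := flat_bounded (p * 'X^2).
  have bnd h : `|flat p h| <= C * `|h| ^+ 2.
    have [h0|h0] := leP h 0; first by rewrite flat_le0// normr0 mulr_ge0// ltW.
    rewrite (flatMXn p 2 (ltW h0)) normrM normrX mulrC.
    by rewrite ler_pM2r ?exprn_gt0 ?normr_gt0 ?gt_eqF.
  have cv : h^-1 *: (flat p (h *: 1 + 0) - flat p 0) @[h --> 0^'] --> (0 : R).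
    apply/cvgrPdist_le => e e0; near=> h.
    have hn0 : h != 0 by near: h; exact: nbhs_dnbhs_neq.
    rewrite sub0r normrN addr0 (flat_le0 _ (lexx 0)) subr0.
    rewrite /GRing.scale/= mulr1 normrM normfV mulrC ler_pdivrMr ?normr_gt0//.
    apply: (le_trans (bnd h)); rewrite expr2 mulrA ler_pM2r ?normr_gt0//.
    rewrite mulrC -ler_pdivlMr//.
    by apply: ltW; near: h; apply: dnbhs0_lt; rewrite divr_gt0.
  apply: DeriveDef; first by apply/cvg_ex; exists 0.
  exact: cvg_lim cv.
Unshelve. all: by end_near. Qed.

Lemma differentiable_flat p x : differentiable (flat p) x.
Proof. by apply/derivable1_diffP; have [] := is_derive_flat p x. Qed.

Lemma flat1_ge0 x : 0 <= flat 1 x.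
Proof.
rewrite /flat; case: ifP => // _.
by rewrite hornerC mul1r expR_ge0.
Qed.

Lemma flat1_gt0 x : 0 < x -> 0 < flat 1 x.
Proof. by rewrite /flat => ->; rewrite hornerC mul1r expR_gt0. Qed.

Lemma flat1_mono x y : x <= y -> flat 1 x <= flat 1 y.
Proof.
have [x0|x0] := leP x 0; first by rewrite flat_le0// flat1_ge0.
move=> xy; have y0 := lt_le_trans x0 xy.
by rewrite /flat x0 y0 !hornerC !mul1r ler_expR lerN2 lef_pV2.
Qed.

End FlatBump.

(** * Closure properties of smooth functions on open sets of R^n *)

Section SmoothAlgebra.
Context {R : realType}.
Set Implicit Arguments.
Unset Strict Implicit.

Lemma near_eq_differentiable (V W : normedModType R) (f f' : V -> W) (x : V) :
  {near x, f =1 f'} -> differentiable f x -> differentiable f' x.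
Proof.
move=> ff' /diff_locallyP[cdf fE].
have f'E : f' \o shift x = cst (f' x) + 'd f x +o_ 0 id.
  apply/eqaddoP => e e0.
  have /eqaddoP/(_ _ e0) := fE.
  have ff'0 : \forall h \near (0 : V), f (h + x) = f' (h + x).
    by move: ff'; rewrite (near_shift 0 x) /=; apply: filterS => h /=; rewrite subr0.
  apply: filterS2 ff'0 => h /= fh.
  by rewrite !fctE /= fh (nbhs_singleton ff').
by apply/diff_locallyP; rewrite (diff_unique cdf f'E).
Qed.

Section Class.
Context {n : nat} {W : normedModType R}.
Variables (V : set 'rV[R]_n) (oV : open V).
Implicit Types f : 'rV[R]_n -> W.

(** By induction on the list of directions, each iterated derivative agrees on [V] with a member of
    [P]. Since [V] is open, agreement on [V] passes to derivatives and to differentiability. *)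
Lemma smooth_on_class (P : ('rV[R]_n -> W) -> Prop) :
  (forall f, P f -> forall y, V y -> differentiable f y) ->
  (forall f v, P f -> exists2 f', P f' & forall y, V y -> 'D_v f y = f' y) ->
  forall f, P f -> smooth_on V f.
Proof.
move=> Pd PD f Pf.
have near_V y g g' : V y -> (forall z, V z -> g z = g' z) -> {near y, g =1 g'}.
  by move=> Vy gg'; have := open_nbhs_nbhs (conj oV Vy); apply: filterS.
have key vs : exists2 g, P g &
    forall y, V y -> foldr (fun v h z => 'D_v h z) f vs y = g y.
  elim: vs => [|v vs [g Pg fg]]; first by exists f.
  have [g' Pg' gg'] := PD g v Pg.
  exists g' => // y Vy /=; rewrite -gg'//.
  exact/near_eq_derive/near_V.
move=> vs y Vy; have [g Pg fg] := key vs.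
apply: (@near_eq_differentiable _ _ g); last exact: Pd.
by apply: near_V => // z Vz; rewrite fg.
Qed.

Lemma smooth_on_derive f v : smooth_on V f -> smooth_on V (fun z => 'D_v f z).
Proof. by move=> sf vs y Vy; have := sf (rcons vs v) y Vy; rewrite foldr_rcons. Qed.

Lemma smooth_on_differentiable f y : smooth_on V f -> V y -> differentiable f y.
Proof. by move=> sf Vy; exact: (sf [::]). Qed.

Lemma smooth_on_eq f f' : (forall y, V y -> f y = f' y) ->
  smooth_on V f -> smooth_on V f'.
Proof.
move=> ff' sf.
apply: (@smooth_on_class (fun g => exists2 h, smooth_on V h &
  forall y, V y -> h y = g y)); last by exists f.
- move=> g [h sh hg] y Vy; apply: (@near_eq_differentiable _ _ h).
    by have := open_nbhs_nbhs (conj oV Vy); apply: filterS.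
  exact: smooth_on_differentiable.
- move=> g v [h sh hg]; exists (fun z => 'D_v g z) => //.
  exists (fun z => 'D_v h z); first exact: smooth_on_derive.
  move=> y Vy; apply: near_eq_derive.
  by have := open_nbhs_nbhs (conj oV Vy); apply: filterS.
Qed.

Lemma smooth_on_cst (c : W) : smooth_on V (fun=> c).
Proof.
apply: (@smooth_on_class (fun g => exists c, g = cst c)); last by exists c.
- by move=> _ [d ->] y _; exact: differentiable_cst.
- by move=> _ v [d ->]; exists (cst 0) => [|y _]; [exists 0|rewrite derive_cst].
Qed.

End Class.

Lemma smooth_on_local (n : nat) (W : normedModType R) (V : set 'rV[R]_n)
    (f : 'rV[R]_n -> W) :
  (forall y, V y -> exists2 V', V' y & smooth_on V' f) -> smooth_on V f.
Proof. by move=> h vs y Vy; have [V' V'y sf] := h y Vy; exact: sf. Qed.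

Lemma smooth_on_coord (n m : nat) (V : set 'rV[R]_n) (F : 'rV[R]_n -> 'rV[R]_m)
    (k : 'I_m) : open V -> smooth_on V F -> smooth_on V (fun y => F y 0 k : R).
Proof.
move=> oV sF.
apply: (@smooth_on_class _ _ _ oV (fun g => exists2 G : 'rV[R]_n -> 'rV[R]_m,
    smooth_on V G & forall y, V y -> g y = G y 0 k)); last by exists F.
- move=> g [G sG gG] y Vy.
  apply: (@near_eq_differentiable _ _ ((fun z : 'rV[R]_m => z 0 k : R) \o G)).
    have := open_nbhs_nbhs (conj oV Vy); apply: filterS => z Vz.
    by rewrite /= gG.
  apply: differentiable_comp; first exact: smooth_on_differentiable Vy.
  exact: differentiable_coord.
- move=> g v [G sG gG]; exists (fun z => ('D_v G z) 0 k).
    by exists (fun z => 'D_v G z) => //; exact: smooth_on_derive.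
  move=> y Vy.
  rewrite derive_mx ?mxE; last first.
    by apply: diff_derivable; exact: smooth_on_differentiable Vy.
  by apply: near_eq_derive; have := open_nbhs_nbhs (conj oV Vy); apply: filterS.
Qed.

Lemma derive_flat_comp (n : nat) (p : {poly R}) (f : 'rV[R]_n -> R) (y v : 'rV[R]_n) :
  differentiable f y ->
  'D_v (fun z => flat p (f z)) y =
  flat ((p - p^`()) * 'X^2) (f y) * 'D_v f y.
Proof.
move=> df; have dflat := differentiable_flat p (f y).
rewrite deriveE; last exact: (@differentiable_comp _ _ _ _ f).
rewrite (@diff_comp _ _ _ _ f)// deriveE// diff1E//= mulrC.
by have /@derive_val := is_derive_flat p (f y); rewrite derive1E => ->.
Qed.

(* A class of differentiable functions that is closed under directional derivatives
   up to equality on [V], which is what [smooth_on_class] asks for. *)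
Inductive smooth_term (n : nat) (V : set 'rV[R]_n) : ('rV[R]_n -> R) -> Prop :=
| SmoothBase f : smooth_on V f -> smooth_term V f
| SmoothAdd f f' : smooth_term V f -> smooth_term V f' ->
    smooth_term V (fun y => f y + f' y)
| SmoothMul f f' : smooth_term V f -> smooth_term V f' ->
    smooth_term V (fun y => f y * f' y)
| SmoothFlat p f : smooth_term V f -> smooth_term V (fun y => flat p (f y)).

Lemma smooth_term_smooth (n : nat) (V : set 'rV[R]_n) (f : 'rV[R]_n -> R) :
  open V -> smooth_term V f -> smooth_on V f.
Proof.
move=> oV.
have td g : smooth_term V g -> forall y, V y -> differentiable g y.
  elim=> {g} [g sg|g g' _ IH _ IH'|g g' _ IH _ IH'|p g _ IH] y Vy.
  - exact: smooth_on_differentiable Vy.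
  - by apply: differentiableD; [exact: IH|exact: IH'].
  - by apply: differentiableM; [exact: IH|exact: IH'].
  - by apply: (@differentiable_comp _ _ _ _ g); [exact: IH|exact: differentiable_flat].
apply: smooth_on_class => //.
move=> g v; elim=> {g} [g sg|g g' tg [h th hE] tg' [h' th' hE']
    |g g' tg [h th hE] tg' [h' th' hE']|p g tg [h th hE]].
- by exists (fun z => 'D_v g z) => //; apply: SmoothBase; exact: smooth_on_derive.
- exists (fun y => h y + h' y); first exact: SmoothAdd.
  by move=> y Vy; rewrite -hE// -hE'// -deriveD//; apply/diff_derivable/td.
- exists (fun y => g y * h' y + g' y * h y).
    by apply: SmoothAdd; exact: SmoothMul.
  move=> y Vy; rewrite -hE// -hE'//.
  have := @deriveM _ _ g g' y v; rewrite /GRing.scale/= => <-//;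
    exact/diff_derivable/td.
- exists (fun y => flat ((p - p^`()) * 'X^2) (g y) * h y).
    by apply: SmoothMul => //; exact: SmoothFlat.
  by move=> y Vy; rewrite -hE// derive_flat_comp//; exact: td.
Qed.

Lemma smooth_on_sum (n m : nat) (V : set 'rV[R]_n) (F : 'I_m -> 'rV[R]_n -> R) :
  open V -> (forall j, smooth_on V (F j)) ->
  smooth_on V (fun y => \sum_j F j y).
Proof.
move=> oV sF; rewrite (_ : (fun y => _) = fun y => \sum_(j <- index_enum 'I_m) F j y)//.
elim: (index_enum _) => [|j s IH].
  by apply: (smooth_on_eq oV _ (smooth_on_cst oV 0)) => y _; rewrite big_nil.
apply: (@smooth_on_eq _ _ _ oV (fun y => F j y + \sum_(k <- s) F k y)).
  by move=> y _; rewrite big_cons.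
by apply: smooth_term_smooth => //; apply: SmoothAdd; exact: SmoothBase.
Qed.

End SmoothAlgebra.

(** * Positive definite matrices: determinant, Cauchy-Schwarz, coercivity *)

Section PositiveDefinite.
Context {R : realType} {n : nat}.
Set Implicit Arguments.
Unset Strict Implicit.
Implicit Types (G : 'M[R]_n) (v w x y z : 'rV[R]_n).

Definition bilin G v w : R := (v *m G *m w^T) 0 0.

Lemma bilinDl G v v' w : bilin G (v + v') w = bilin G v w + bilin G v' w.
Proof. by rewrite /bilin !mulmxDl mxE. Qed.

Lemma bilinZl G a v w : bilin G (a *: v) w = a * bilin G v w.
Proof. by rewrite /bilin -!scalemxAl mxE. Qed.

Lemma bilinDr G v w w' : bilin G v (w + w') = bilin G v w + bilin G v w'.
Proof. by rewrite /bilin linearD mulmxDr mxE. Qed.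

Lemma bilinZr G a v w : bilin G v (a *: w) = a * bilin G v w.
Proof. by rewrite /bilin linearZ -scalemxAr mxE. Qed.

Lemma bilinC G v w : G^T = G -> bilin G v w = bilin G w v.
Proof.
move=> sG; transitivity ((v *m G *m w^T)^T 0 0); first by rewrite mxE.
by rewrite !trmx_mul trmxK sG /bilin mulmxA.
Qed.

Lemma bilinE G v w : bilin G v w = \sum_i \sum_j v 0 i * G i j * w 0 j.
Proof.
rewrite exchange_big /bilin mxE/=; apply: eq_bigr => j _.
by rewrite !mxE mulr_suml.
Qed.

(** The norm of row vectors is the sup norm, so its balls are coordinate cubes. *)
Lemma norm_coord v j : `|v 0 j| <= `|v|.
Proof. by rewrite [leRHS]/Num.Def.normr/= mx_normrE; exact: (le_bigmax _ _ (0, j)). Qed.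

Lemma norm_rV_le v (c : R) : 0 <= c -> (forall j, `|v 0 j| <= c) -> `|v| <= c.
Proof.
move=> c0 h; rewrite [leLHS]/Num.Def.normr/= mx_normrE bigmax_le// => -[i j] _ /=.
by rewrite ord1.
Qed.

Lemma norm_rV_lt v (c : R) : 0 < c -> (forall j, `|v 0 j| < c) -> `|v| < c.
Proof.
move=> c0 h; rewrite [ltLHS]/Num.Def.normr/= mx_normrE bigmax_lt// => -[i j] _ /=.
by rewrite ord1.
Qed.

Lemma bilin_le G v w (c : R) : (forall i j, `|G i j| <= c) ->
  `|bilin G v w| <= n%:R ^+ 2 * c * `|v| * `|w|.
Proof.
move=> Gc; rewrite bilinE.
apply: (@le_trans _ _ (\sum_(i < n) \sum_(j < n) c * `|v| * `|w|)).
  apply: le_trans (ler_norm_sum _ _ _) _; apply: ler_sum => i _.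
  apply: le_trans (ler_norm_sum _ _ _) _; apply: ler_sum => j _.
  rewrite !normrM (mulrC `|v 0 i|) ler_pM ?mulr_ge0//; last exact: norm_coord.
  by rewrite ler_pM//; exact: norm_coord.
rewrite !sumr_const !card_ord -mulrnA -[leLHS]mulr_natl natrM.
by rewrite le_eqVlt; apply/orP; left; apply/eqP; ring.
Qed.

Definition posdef G := forall v, v != 0 -> 0 < bilin G v v.

Lemma posdef_ge0 G v : posdef G -> 0 <= bilin G v v.
Proof.
move=> pG; have [->|v0] := eqVneq v 0; last exact/ltW/pG.
by rewrite /bilin !mul0mx mxE.
Qed.

(** The quadratic form vanishes on the kernel of [G]. *)
Lemma posdef_unitmx G : posdef G -> G \in unitmx.
Proof.
move=> pG; rewrite -row_free_unit -kermx_eq0; apply/eqP/row_matrixP => i.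
rewrite row0; apply/eqP; apply: contraT => /pG.
have /eqP : row i (kermx G) *m G = 0.
  by rewrite -row_mul mulmx_ker row0.
by rewrite /bilin => /eqP ->; rewrite mul0mx mxE ltxx.
Qed.

Lemma posdef_det_gt0 G : posdef G -> 0 < \det G.
Proof.
move=> pG.
(* The matrices on the segment from [1%:M] to [G] are positive definite, hence
   invertible, so their determinant does not change sign. *)
pose H := map_mx polyC 1%:M + 'X *: map_mx polyC (G - 1%:M) : 'M[{poly R}]_n.
have HE t : (\det H).[t] = \det (1%:M + t *: (G - 1%:M)).
  rewrite -horner_evalE -det_map_mx; congr (\det _).
  by apply/matrixP => i j; rewrite !mxE/= /horner_eval hornerD hornerM hornerX !hornerC.
have Hn0 t : 0 <= t <= 1 -> (\det H).[t] != 0.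
  move=> /andP[t0 t1]; rewrite HE -unitfE -/(unitmx _); apply: posdef_unitmx => v v0.
  have -> : 1%:M + t *: (G - 1%:M) = (1 - t) *: 1%:M + t *: G.
    by rewrite scalerBr scalerBl scale1r addrA addrAC.
  have vv : bilin 1%:M v v = \sum_j v 0 j ^+ 2.
    by rewrite /bilin mulmx1 mxE; apply: eq_bigr => j _; rewrite mxE expr2.
  have vv0 : 0 < bilin 1%:M v v.
    rewrite vv lt_def sumr_ge0 ?andbT => [|j _]; last exact: sqr_ge0.
    apply: contra v0; rewrite psumr_eq0 => [/allP h|j _]; last exact: sqr_ge0.
    apply/eqP/rowP => j; have := h j (mem_index_enum _).
    by rewrite sqrf_eq0 mxE => /eqP.
  have -> : bilin ((1 - t) *: 1%:M + t *: G) v v =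
      (1 - t) * bilin 1%:M v v + t * bilin G v v.
    by rewrite /bilin mulmxDr mulmxDl mxE -!scalemxAr -!scalemxAl !mxE.
  have := pG v v0; move: vv0 => {vv}; set a := bilin _ v v; set b := bilin _ v v => a0 b0.
  have [->|tn0] := eqVneq t 0; first by rewrite subr0 mul1r mul0r addr0.
  apply: ltr_wpDl; first by rewrite mulr_ge0 ?subr_ge0// ltW.
  by rewrite mulr_gt0// lt_def tn0.
have H0 : (\det H).[0] = 1 by rewrite HE scale0r addr0 det1.
have H1 : (\det H).[1] = \det G by rewrite HE scale1r addrC subrK.
rewrite ltNge -H1; apply/negP => H1le.
(* The sign is reversed because [poly_ivt] wants a value [<= 0] at the left end and [>= 0] at the
   right end. *)
have [|t t01 /rootP Ht] := @poly_ivt R (- \det H) 0 1 ler01.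
  by rewrite !hornerN oppr_le0 oppr_ge0 H0 H1le ler01.
have := Hn0 t t01.
by move=> /eqP; apply; apply/eqP; rewrite -oppr_eq0 -hornerN Ht.
Qed.

(** The form is nonnegative at [bilin G w w *: v - bilin G v w *: w], where its value is
    [bilin G w w] times the difference of the two sides. *)
Lemma posdef_CauchySchwarz G v w : G^T = G -> posdef G ->
  bilin G v w ^+ 2 <= bilin G v v * bilin G w w.
Proof.
move=> sG pG; have [->|w0] := eqVneq w 0.
  by rewrite /bilin !trmx0 !mulmx0 mxE expr0n/= mulr0.
have qw := pG w w0.
have := posdef_ge0 (bilin G w w *: v + - bilin G v w *: w) pG.
rewrite !(bilinDl, bilinDr, bilinZl, bilinZr) (bilinC w v sG).
move: (bilin G v w) (bilin G v v) (bilin G w w) qw => b a c c0 h.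
rewrite -subr_ge0 -(pmulr_rge0 _ c0); apply: le_trans h _.
by rewrite le_eqVlt; apply/orP; left; apply/eqP; ring.
Qed.

Lemma posdef_coercive G : G^T = G -> posdef G ->
  exists2 a : R, 0 < a & forall v, a * `|v| ^+ 2 <= bilin G v v.
Proof.
move=> sG pG.
have uG := posdef_unitmx pG.
(* [v 0 j] is the product of [v] and [e j] for [G]: apply Cauchy-Schwarz. *)
pose e j : 'rV[R]_n := delta_mx 0 j *m invmx G.
(* [S] dominates every [bilin G (e j) (e j)]; the summand 1 keeps it positive when [n = 0]. *)
pose S := 1 + \sum_j bilin G (e j) (e j).
have S0 : 0 < S.
  by rewrite ltr_pwDl// sumr_ge0// => j _; exact: posdef_ge0.
have eS j : bilin G (e j) (e j) <= S.
  rewrite /S (bigD1 j)//= addrCA lerDl addr_ge0// sumr_ge0// => k _.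
  exact: posdef_ge0.
exists S^-1 => [|v]; first by rewrite invr_gt0.
have vv0 := posdef_ge0 v pG.
rewrite mulrC ler_pdivrMr//.
have vj j : `|v 0 j| <= Num.sqrt (bilin G v v * S).
  rewrite -sqrtr_sqr ler_wsqrtr//.
  have -> : v 0 j = bilin G v (e j).
    rewrite bilinC// /bilin /e mulmxKV//.
    by rewrite mxE (bigD1 j)//= big1 ?addr0 => [|k kj]; rewrite !mxE ?eqxx ?mul1r//
       (negbTE kj) andbF mul0r.
  apply: le_trans (posdef_CauchySchwarz v (e j) sG pG) _.
  by rewrite ler_wpM2l.
have vn : `|v| <= Num.sqrt (bilin G v v * S) by apply: norm_rV_le; rewrite ?sqrtr_ge0.
rewrite -(sqr_sqrtr (mulr_ge0 vv0 (ltW S0))) ler_pXn2r ?nnegrE ?sqrtr_ge0//.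
Qed.

End PositiveDefinite.

(** * Charts with controlled metric, and the volume of chart balls *)

Section Geometry.
Context {R : realType} {n : nat}.
Set Implicit Arguments.
Unset Strict Implicit.

Lemma cvg_det (T : Type) (F : set_system T) (FF : Filter F)
    (G : T -> 'M[R]_n) (G0 : 'M[R]_n) :
  (forall k l, (G y k l) @[y --> F] --> G0 k l) -> \det (G y) @[y --> F] --> \det G0.
Proof.
move=> GF; rewrite /determinant; apply: cvg_big => [|s _].
  exact: add_continuous.
apply: cvgM; first exact: cvg_cst.
by apply: cvg_big => [|k _]; [exact: mul_continuous|exact: GF].
Qed.

Context {M : ptopologicalType}.
Variable g : riemannian_manifold R n M.
Implicit Types (i : chart_index g) (c y z : 'rV[R]_n) (x : M).

Definition image i : set 'rV[R]_n := chart i @` cdom i.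

Lemma image_chart i x : cdom i x -> image i (chart i x).
Proof. by move=> ix; exists x. Qed.

Lemma cdom_param i y : image i y -> cdom i (param i y).
Proof. by move=> [x ix <-]; rewrite chartK. Qed.

Lemma paramK i y : image i y -> chart i (param i y) = y.
Proof. by move=> [x ix <-]; rewrite chartK. Qed.

Lemma metric_posdef i y : image i y -> posdef (metric i y).
Proof. exact: metric_pos. Qed.

Lemma near_image i y : image i y -> \forall z \near y, image i z.
Proof. by move=> iy; apply: open_nbhs_nbhs; split => //; exact: cimage_open. Qed.

(* [sqrt (det (metric i y))] is the density of the volume in the chart [i]. *)
Record controlled_ball i c (s a b m m' : R) : Prop := ControlledBall {
  cball_image : forall y, `|y - c| < s -> image i y;
  cball_lower : forall y z, `|y - c| < s -> a * `|z| ^+ 2 <= sqnorm i y z;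
  cball_upper : forall y z, `|y - c| < s -> sqnorm i y z <= b * `|z| ^+ 2;
  cball_density : forall y, `|y - c| < s ->
    m <= Num.sqrt (\det (metric i y)) <= m' }.

Lemma controlled_ball_sub i c c' (s s' a b m m' : R) :
  controlled_ball i c s a b m m' -> `|c' - c| + s' <= s ->
  controlled_ball i c' s' a b m m'.
Proof.
move=> [h1 h2 h3 h4] cc'.
have sub y : `|y - c'| < s' -> `|y - c| < s.
  move=> yc'; have := ler_normD (y - c') (c' - c).
  by rewrite addrA subrK => /le_lt_trans; apply; apply: lt_le_trans cc'; lra.
by split => *; [apply: h1|apply: h2|apply: h3|apply: h4]; exact: sub.
Qed.

(** The metric is continuous at [c]. Close to [c] the quadratic form loses at most half of its
    coercivity constant, and the determinant, positive at [c], changes at most by a factor 2. *)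
Lemma controlled_ball_at i c : image i c ->
  exists s a b m m' : R, [/\ 0 < s, 0 < a, 0 < b, 0 < m &
    controlled_ball i c s a b m m'].
Proof.
move=> ic.
pose G := metric i.
have Gc k l : (G y k l) @[y --> c] --> G c k l.
  have dG : differentiable (fun y => G y k l : R) c := metric_smooth k l [::] ic.
  exact: (differentiable_continuous dG).
have [a a0 aG] := posdef_coercive (Defs.metric_sym ic) (metric_posdef ic).
(* By [bilin_le], entries within [a / 2 / N] change the form by at most [a / 2] times the squared
   norm; the [+ 1] makes [N] positive when [n = 0]. *)
pose N := n%:R ^+ 2 + 1 : R.
have N0 : 0 < N by rewrite ltr_wpDl// exprn_ge0.
have e0 : 0 < a / 2 / N by rewrite !divr_gt0.
pose C : R := \sum_k \sum_l `|G c k l| + a / 2 / N.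
have C0 : 0 < C.
  by rewrite ltr_wpDl// sumr_ge0// => k _; rewrite sumr_ge0.
have d0 : 0 < \det (G c) := posdef_det_gt0 (metric_posdef ic).
have Gnear : \forall y \near c, forall k l, `|G y k l - G c k l| <= a / 2 / N.
  pose P k l : set 'rV[R]_n := [set y | `|G y k l - G c k l| <= a / 2 / N].
  have h k : \forall y \near c, forall l, P k l y.
    apply: (@filter_forall _ _ (P k) (nbhs c) (nbhs_filter c)) => l.
    have /cvgrPdist_le/(_ _ e0) := Gc k l.
    by apply: filterS => y; rewrite distrC.
  exact: (@filter_forall _ _ (fun k y => forall l, P k l y) (nbhs c) (nbhs_filter c)).
have dnear : \forall y \near c, \det (G c) / 2 <= \det (G y) <= \det (G c) * 2.
  have d20 : 0 < \det (G c) / 2 by rewrite divr_gt0.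
  have /cvgrPdist_le/(_ _ d20) := cvg_det (nbhs_filter c) Gc.
  by apply: filterS => y; rewrite ler_distlC => /andP[? ?]; apply/andP; split; lra.
have /nbhs_ballP[s s0 sP] : \forall y \near c,
    [/\ image i y, forall k l, `|G y k l - G c k l| <= a / 2 / N &
      \det (G c) / 2 <= \det (G y) <= \det (G c) * 2].
  by near=> y; split; near: y => //; exact: near_image.
have {}sP y : `|y - c| < s -> [/\ image i y,
    forall k l, `|G y k l - G c k l| <= a / 2 / N &
    \det (G c) / 2 <= \det (G y) <= \det (G c) * 2].
  by move=> yc; apply: sP; rewrite -ball_normE/= distrC.
have sqnormB y z : sqnorm i y z = sqnorm i c z + bilin (G y - G c) z z.
  by rewrite /sqnorm /bilin -[metric i y](subrK (G c)) addrC mulmxDr mulmxDl [LHS]mxE.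
have n2 : n%:R ^+ 2 * (a / 2 / N) <= a / 2.
  rewrite mulrA ler_pdivrMr// mulrC ler_pM2l ?divr_gt0//.
  by rewrite lerDl.
exists s, (a / 2), (n%:R ^+ 2 * C + 1), (Num.sqrt (\det (G c) / 2)),
  (Num.sqrt (\det (G c) * 2)); split.
- exact: s0.
- by rewrite divr_gt0.
- by rewrite ltr_wpDl// mulr_ge0 ?exprn_ge0// ltW.
- by rewrite sqrtr_gt0 divr_gt0.
split.
- by move=> y /sP[].
- move=> y z /sP[_ yG _]; rewrite sqnormB.
  have yG' k l : `|(G y - G c) k l| <= a / 2 / N by rewrite !mxE.
  have := bilin_le z z yG'; rewrite ler_norml => /andP[+ _].
  have : a * `|z| ^+ 2 <= sqnorm i c z := aG z.
  have : n%:R ^+ 2 * (a / 2 / N) * `|z| * `|z| <= a / 2 * `|z| ^+ 2.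
    by rewrite -mulrA -expr2 ler_wpM2r// exprn_ge0.
  lra.
- move=> y z /sP[_ yG _].
  have GC k l : `|G y k l| <= C.
    rewrite -(subrK (G c k l) (G y k l)) (le_trans (ler_normD _ _))// addrC lerD//.
    rewrite (bigD1 k)//= (bigD1 l)//= -addrA lerDl addr_ge0//.
      by rewrite sumr_ge0.
    by rewrite sumr_ge0// => ? _; rewrite sumr_ge0.
  have := bilin_le z z GC; rewrite ler_norml => /andP[_].
  rewrite /sqnorm /bilin => /le_trans; apply.
  by rewrite -mulrA -expr2 ler_wpM2r ?exprn_ge0// lerDl.
- move=> y /sP[_ _ /andP[h1 h2]]; apply/andP; split; exact: ler_wsqrtr.
Unshelve. all: by end_near. Qed.

Definition chart_ball i c (t : R) : set M := [set x | cdom i x /\ `|chart i x - c| < t].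

Lemma open_chart_ball i c t : open (chart_ball i c t).
Proof.
rewrite openE => x [ix xt]; rewrite /interior.
have cx : {for x, continuous (chart i)} := chart_continuous ix.
have h1 : \forall x' \near x, cdom i x'.
  by apply: open_nbhs_nbhs; split => //; exact: cdom_open.
have h2 : \forall y \near chart i x, `|y - c| < t.
  have o : open [set y : 'rV[R]_n | `|y - c| < t].
    rewrite (_ : [set _ | _] = ball c t); first exact: ball_open.
    by apply/seteqP; split => y; rewrite -ball_normE/= distrC.
  exact: open_nbhs_nbhs.
by near=> x'; split; near: x' => //; exact: (cx _ h2).
Unshelve. all: by end_near. Qed.

Lemma measurable_open (A : set (borel M)) : @open M A -> measurable A.
Proof. exact: sub_sigma_algebra. Qed.

Section Volume.
Variables (mu : {measure set (borel M) -> \bar R}) (vol : is_riemannian_volume g mu).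
Variables (i : chart_index g) (c : 'rV[R]_n) (s a b m m' : R).
Hypothesis good : controlled_ball i c s a b m m'.

Let cube (t : R) : set (n.-tuple (measurableTypeR R)) :=
  [set u | forall j, `|tnth u j - c 0 j| < t].

(** Since [t <= s], the whole cube lies in the image of the chart, so it is exactly the image of the
    chart ball. *)
Lemma chart_ball_volume (t : R) : 0 < t -> t <= s ->
  (mu (chart_ball i c t) = \int[@lebesgue_tuple R n]_(u in cube t)
     (Num.sqrt (\det (metric i (row_of_tuple u))))%:E)%E.
Proof.
move=> t0 ts; rewrite (vol (measurable_open (open_chart_ball _ _ _)) (fun _ => @proj1 _ _)).
congr (integral _ _ _); apply/seteqP; split => u /=.
  move=> [x [ix xt] xu] j; apply: le_lt_trans xt; rewrite xu.
  by have := norm_coord (row_of_tuple u - c) j; rewrite !mxE.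
move=> h.
have uc : `|row_of_tuple u - c| < t by apply: norm_rV_lt => // j; rewrite !mxE.
have iu := cball_image good (lt_le_trans uc ts).
exists (param i (row_of_tuple u)); last exact: paramK.
by split; [exact: cdom_param|rewrite paramK].
Qed.

Lemma cube_density (t : R) u : t <= s -> cube t u -> 0 < t ->
  m <= Num.sqrt (\det (metric i (row_of_tuple u))) <= m'.
Proof.
move=> ts ut t0; apply: (cball_density good); apply: lt_le_trans ts.
by apply: norm_rV_lt => // j; rewrite !mxE; exact: ut.
Qed.

Lemma chart_ball_volume_le (t : R) : 0 < t -> t <= s ->
  (mu (chart_ball i c t) <= (m' * (2 * t) ^+ n)%:E)%E.
Proof.
move=> t0 ts; rewrite chart_ball_volume// EFinM -(lebesgue_tuple_cube (fun j => c 0 j) (ltW t0)).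
have [l lE] := @lebesgue_tuple_sigma_finite R n; rewrite lE.
rewrite -integral_cst; last exact: measurable_cube.
apply: ge0_le_integral_nonmeasurable => u ut; rewrite lee_fin ?sqrtr_ge0//.
by case/andP: (cube_density ts ut t0).
Qed.

Lemma chart_ball_volume_ge (t : R) : 0 <= m -> 0 < t -> t <= s ->
  ((m * (2 * t) ^+ n)%:E <= mu (chart_ball i c t))%E.
Proof.
move=> m0 t0 ts; rewrite chart_ball_volume// EFinM -(lebesgue_tuple_cube (fun j => c 0 j) (ltW t0)).
have [l lE] := @lebesgue_tuple_sigma_finite R n; rewrite lE.
rewrite -integral_cst; last exact: measurable_cube.
apply: ge0_le_integral_nonmeasurable => u ut; rewrite lee_fin//.
by case/andP: (cube_density ts ut t0).
Qed.

End Volume.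
End Geometry.

(** * Geodesic balls compared with chart balls *)

Section Distance.
Context {R : realType} {n : nat} {M : ptopologicalType}.
Variable g : riemannian_manifold R n M.
Set Implicit Arguments.
Unset Strict Implicit.
Implicit Types (i : chart_index g) (c y z : 'rV[R]_n) (x : M).

Lemma geodesic_ballP x (r : R) x' : geodesic_ball g x r x' <->
  exists2 e, curve_from_to x e x' & (@curve_length R n M g e < r%:E)%E.
Proof.
split=> [/ereal_inf_lt/= [_ [e xex' <-] er]|[e xex' er]]; first by exists e.
by apply: le_lt_trans er; apply: ereal_inf_lbound; exists e.
Qed.

Lemma geodesic_ball_center x (r : R) : 0 < r -> geodesic_ball g x r x.
Proof.
move=> r0; apply/geodesic_ballP; exists [::] => //.
by rewrite /curve_length big_nil lte_fin.
Qed.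

Lemma geodesic_ball_le x (r r' : R) : r <= r' -> geodesic_ball g x r `<=` geodesic_ball g x r'.
Proof. by move=> rr' x' /= /lt_le_trans; apply; rewrite lee_fin. Qed.

Lemma curve_from_to_cat (e e' : seq (C1_arc g)) x x' x'' :
  curve_from_to x e x' -> curve_from_to x' e' x'' -> curve_from_to x (e ++ e') x''.
Proof.
elim: e x => [|a e IH] x /=; first by move=> ->.
by move=> [ha ax ax'] x'x''; split => //; exact: IH.
Qed.

Lemma geodesic_ball_trans x x' x'' (r r' : R) :
  geodesic_ball g x r x' -> geodesic_ball g x' r' x'' ->
  geodesic_ball g x (r + r') x''.
Proof.
move=> /geodesic_ballP[e xx' er] /geodesic_ballP[e' x'x'' er'].
apply/geodesic_ballP; exists (e ++ e'); first exact: curve_from_to_cat x'x''.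
by rewrite /curve_length big_cat/= EFinD lteD.
Qed.

Lemma ball_convex c y z (s t : R) : `|y - c| < s -> `|z - c| < s -> 0 <= t <= 1 ->
  `|y + t *: (z - y) - c| < s.
Proof.
move=> yc zc /andP[t0 t1].
have -> : y + t *: (z - y) - c = (1 - t) *: (y - c) + t *: (z - c).
  by apply/rowP => j; rewrite !mxE; ring.
apply: le_lt_trans (ler_normD _ _) _; rewrite !normrZ !ger0_norm ?subr_ge0//.
have [->|tn0] := eqVneq t 0; first by rewrite subr0 mul1r mul0r addr0.
have t0' : 0 < t by rewrite lt_def tn0.
have h1 : (1 - t) * `|y - c| <= (1 - t) * s by rewrite ler_wpM2l ?subr_ge0// ltW.
have h2 : t * `|z - c| < t * s by rewrite ltr_pM2l.
by lra.
Qed.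

(** The straight segment from [y] to [z] stays in the cube by convexity; it is a single arc, of
    length at most [Num.sqrt b] times its Euclidean length in the sup norm. *)
Lemma segment_geodesic_ball i c (s a b m m' : R) y z (r : R) :
  controlled_ball i c s a b m m' -> `|y - c| < s -> `|z - c| < s ->
  Num.sqrt b * `|z - y| < r ->
  geodesic_ball g (param i y) r (param i z).
Proof.
move=> good yc zc zr.
pose f t : 'rV[R]_n := y + t *: (z - y).
have df (t : R) : is_derive t 1 f (z - y).
  have dw := @is_diff_scalel R 'rV[R]_n t (z - y).
  have h : is_derive t (1 : R) (fun t : R => t *: (z - y)) (z - y).
    apply: DeriveDef; first exact/diff_derivable/(@ex_diff _ _ _ _ _ _ _ dw).
    by rewrite deriveE; [rewrite diff_val scale1r|exact: (@ex_diff _ _ _ _ _ _ _ dw)].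
  by have := is_deriveD (is_derive_cst y t 1) h; rewrite add0r.
have f' : derive1 f = cst (z - y).
  by apply/funext => t; rewrite derive1E; have [_] := df t.
have fc t : 0 <= t <= 1 -> `|f t - c| < s by move=> ?; exact: ball_convex.
apply/geodesic_ballP; exists [:: (i, f)].
  have arc : is_arc (i, f).
    split => [t|t _|] /=.
    - by rewrite in_itv/= => /fc/(cball_image good).
    - by have [] := df t.
    - by rewrite f' => t; exact: cst_continuous.
  by split => //=; [rewrite /f scale0r addr0|rewrite /f scale1r addrC subrK].
rewrite /curve_length big_seq1 /arc_length/= f'.
apply: (@le_lt_trans _ _ (\int[lebesgue_measure]_(t in `[0%R, 1%R])
    (Num.sqrt b * `|z - y|)%:E)%E).
  apply: ge0_le_integral_nonmeasurable => t /=; rewrite in_itv/= => t01.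
    by rewrite lee_fin sqrtr_ge0.
  rewrite lee_fin /cst -[X in _ <= _ * X](ger0_norm (normr_ge0 _)) -sqrtr_sqr.
  rewrite mulrC -sqrtrM ?exprn_ge0// mulrC ler_wsqrtr//.
  exact: (cball_upper good) (fc _ t01).
by rewrite integral_cst//= lebesgue_measure_itv/= lte_fin ltr01 oppr0 adde0 mule1 lte_fin.
Qed.

Lemma chart_ball_sub_geodesic_ball i c (s a b m m' r t : R) :
  controlled_ball i c s a b m m' -> 0 < b -> 0 < s -> t <= s -> Num.sqrt b * t <= r ->
  chart_ball i c t `<=` geodesic_ball g (param i c) r.
Proof.
move=> good b0 s0 ts tr x [ix xt].
rewrite -(chartK ix).
apply: (segment_geodesic_ball good); rewrite ?subrr ?normr0//.
  exact: lt_le_trans ts.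
by apply: lt_le_trans tr; rewrite ltr_pM2l// sqrtr_gt0.
Qed.

End Distance.

(** * Gradient bounds and the variation of a function along curves *)

Section GradientBound.
Context {R : realType} {n : nat} {M : ptopologicalType}.
Variable g : riemannian_manifold R n M.
Set Implicit Arguments.
Unset Strict Implicit.
Implicit Types (i : chart_index g) (y z w : 'rV[R]_n) (x : M) (u : M -> R).

(* [|du| <= L] for the operator norm defined by the metric, read in every chart. *)
Definition grad_bound u (L : R) := forall i y w, image i y ->
  ('D_w (u \o param i) y) ^+ 2 <= L ^+ 2 * sqnorm i y w.

Lemma sqnorm_ge0 i y w : image i y -> 0 <= sqnorm i y w.
Proof. by move=> iy; apply: posdef_ge0; exact: metric_posdef. Qed.

Lemma grad_bound_le u (L L' : R) : 0 <= L -> L <= L' -> grad_bound u L -> grad_bound u L'.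
Proof.
move=> L0 LL' uL i y w iy; apply: le_trans (uL i y w iy) _.
by rewrite ler_wpM2r ?sqnorm_ge0// ler_pXn2r ?nnegrE// (le_trans L0).
Qed.

Lemma image_chart_at x : image (chart_at g x) (chart (chart_at g x) x).
Proof. by apply: image_chart; rewrite /chart_at; case: cid. Qed.

Lemma derive_rV_sum (f : 'rV[R]_n -> R) y w : differentiable f y ->
  'D_w f y = \sum_j w 0 j * 'D_(delta_mx 0 j) f y.
Proof.
move=> df; rewrite deriveE// {1}(row_sum_delta w) linear_sum/=.
by apply: eq_bigr => j _; rewrite linearZ/= deriveE.
Qed.

Section GradientNorm.
Variables (u : M -> R) (su : smooth_fun g u).

Lemma smooth_fun_differentiable i y : image i y -> differentiable (u \o param i) y.
Proof. by move=> iy; exact: (su [::]). Qed.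

(** The metric cancels its inverse in the definition of the gradient, leaving [du] evaluated at the
    gradient. *)
Lemma gradient_sqnormE x :
  gradient_sqnorm g u x =
  'D_(gradient g u x) (u \o param (chart_at g x)) (chart (chart_at g x) x).
Proof.
have ix := image_chart_at x.
rewrite derive_rV_sum; last exact: smooth_fun_differentiable.
rewrite /gradient_sqnorm /gradient /sqnorm.
rewrite mulmxKV; last exact/posdef_unitmx/metric_posdef.
by rewrite mxE; apply: eq_bigr => j _; rewrite !mxE mulrC.
Qed.

Lemma gradient_sqnorm_ge0 x : 0 <= gradient_sqnorm g u x.
Proof. exact/sqnorm_ge0/image_chart_at. Qed.

(** For [w] the gradient itself, the bound reads [q ^ 2 <= L ^ 2 * q] with [q] the squared norm;
    divide by [q]. *)
Lemma gradient_sqnorm_le x (L : R) : grad_bound u L ->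
  gradient_sqnorm g u x <= L ^+ 2.
Proof.
move=> /(_ _ _ (gradient g u x) (image_chart_at x)).
rewrite -gradient_sqnormE -/(gradient_sqnorm g u x).
have := gradient_sqnorm_ge0 x; rewrite le_eqVlt => /predU1P[<- _|s0].
  by rewrite exprn_even_ge0.
by rewrite expr2 ler_pM2r.
Qed.

Lemma gradient_sqnorm_eq0 x (d : R) : (\forall x' \near x, u x' = d) ->
  gradient_sqnorm g u x = 0.
Proof.
move=> ud; have ix := image_chart_at x.
rewrite gradient_sqnormE (@near_eq_derive _ _ _ _ (cst d)) ?derive_cst//.
have px : param (chart_at g x) (chart (chart_at g x) x) = x.
  by rewrite chartK// /chart_at; case: cid.
have pc : {for chart (chart_at g x) x, continuous (param (chart_at g x))}.
  exact: (param_continuous ix).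
rewrite /prop_for /continuous_at px in pc.
exact: pc ud.
Qed.

(** By the fundamental theorem of calculus the drop of [u] is the integral of [- D], and [|D|] is at
    most [L] times the speed of the arc. *)
Lemma arc_grad_bound (e : C1_arc g) (L : R) : grad_bound u L -> 0 < L -> is_arc e ->
  ((u (param e.1 (e.2 0%R)) - u (param e.1 (e.2 1%R)))%:E <= L%:E * arc_length e)%E.
Proof.
case: e => i f uL L0 [/= fi df cf'].
pose U := u \o param i.
pose D (t : R) : R := 'D_(derive1 f t) U (f t).
have dU (t : R) : t \in `[0, 1] -> differentiable U (f t).
  by move=> t01; apply: smooth_fun_differentiable; exact: fi.
(* Dividing [u] by [L], rather than multiplying the length by [L], avoids the
   measurability of the integrand of the length. *)
pose F (t : R) : R := - L^-1 * U (f t).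
have dFt (t : R) : t \in `[0, 1] -> is_derive t (1 : R) F (- L^-1 * D t).
  move=> t01; have dft : differentiable f t by apply/derivable1_diffP; exact: df.
  have dUf := differentiable_comp dft (dU _ t01).
  apply: (@is_deriveZ _ _ _ (U \o f)).
  apply: DeriveDef; first exact: diff_derivable.
  rewrite deriveE// diff_comp//= ?/D; last exact: dU.
  by rewrite /D deriveE ?derive1E'//; exact: dU.
(* The direction of the derivative [D] moves with [t]; expanding in coordinates leaves partial
   derivatives of [U] in fixed directions, which are continuous. *)
have cD : {within `[0%R, 1%R], continuous (fun t : R => - L^-1 * D t)}.
  apply: (@subspace_eq_continuous _ _ _ (fun t : R => - L^-1 *
      \sum_j (derive1 f t 0 j) * 'D_(delta_mx 0 j) U (f t))).
    move=> t; rewrite inE/= => t01; rewrite /from_subspace/= /D (derive_rV_sum _ (dU _ t01))//.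
  have cfj j : {within `[0%R, 1%R], continuous (fun t => derive1 f t 0 j)}.
    move=> t; rewrite /from_subspace.
    have cj : {for derive1 f t, continuous (fun w : 'rV[R]_n => w 0 j : R)}.
      exact: coord_continuous.
    exact: continuous_comp (cf' t) cj.
  move=> t; apply: cvgM; first exact: cvg_cst.
  apply: cvg_big => [|j _]; first exact: add_continuous.
  apply: cvgM; first exact: cfj.
  move: t; apply: continuous_in_subspaceT => t; rewrite inE/= => t01.
  apply: (@continuous_comp _ _ _ f (fun y => 'D_(delta_mx 0 j) U y)).
    by apply: differentiable_continuous; apply/derivable1_diffP; exact: df.
  apply: differentiable_continuous.
  exact: smooth_on_differentiable (smooth_on_derive (delta_mx 0 j) (su (i := i))) (fi _ t01).
have F01 : derivable_oo_LRcontinuous F 0 1.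
  have cF (t : R) : t \in `[0, 1] -> {for t, continuous F}.
    move=> /dFt[dF _]; apply: differentiable_continuous; exact/derivable1_diffP.
  split.
  - move=> t t01; have /dFt[] // : t \in `[0, 1] by exact: subset_itv_oo_cc t01.
  - by apply: cvg_at_right_filter; apply: cF; rewrite in_itv/= lexx ler01.
  - by apply: cvg_at_left_filter; apply: cF; rewrite in_itv/= lexx ler01.
have F'D : {in `]0, 1[, F^`()%classic =1 (fun t : R => - L^-1 * D t)}.
  move=> t t01; rewrite derive1E.
  by have /dFt[] : t \in `[0, 1] by exact: subset_itv_oo_cc t01.
have := continuous_FTC2 ltr01 cD F01 F'D.
have -> : ((F 1)%:E - (F 0)%:E)%E =
    (L^-1%:E * (u (param i (f 0)) - u (param i (f 1)))%:E)%E.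
  by rewrite -EFinD -EFinM; congr EFin; rewrite /F /U/=; ring.
move=> FTC; rewrite muleC -lee_pdivrMr// muleC -FTC.
have iD := @continuous_compact_integrable R _ _ (@segment_compact R 0 1) cD.
have mD := measurable_int _ iD.
apply: le_trans (lee_abs _) _; apply: le_trans (le_abse_integral _ _ _) _ => //.
apply: ge0_le_integral_nonmeasurable => t /=; rewrite in_itv/= => t01.
  by rewrite lee_fin.
rewrite lee_fin normrM normrN normfV (gtr0_norm L0) mulrC ler_pdivrMr//.
rewrite -sqrtr_sqr -[X in _ * X](gtr0_norm L0) -[X in _ * X]sqrtr_sqr.
rewrite mulrC -sqrtrM ?exprn_even_ge0// ler_wsqrtr//.
by apply: uL; apply: fi; rewrite in_itv.
Qed.

Lemma curve_grad_bound x (e : seq (C1_arc g)) x' (L : R) :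
  grad_bound u L -> 0 < L -> curve_from_to x e x' ->
  ((u x - u x')%:E <= L%:E * curve_length e)%E.
Proof.
move=> uL L0; elim: e x => [|a e IH] x /=.
  by move=> ->; rewrite subrr mule_ge0// ?lee_fin ?(ltW L0)// /curve_length big_nil.
move=> [arca <- /IH]; rewrite /curve_length big_cons => he.
have al0 (e' : C1_arc g) : (0 <= arc_length e')%E.
  by apply: integral_ge0 => t _; rewrite lee_fin sqrtr_ge0.
rewrite ge0_muleDr ?al0 ?sume_ge0//.
rewrite (_ : u _ - u x' = (u (param a.1 (a.2 0)) - u (param a.1 (a.2 1))) +
  (u (param a.1 (a.2 1)) - u x')); last by rewrite addrA subrK.
by rewrite EFinD leeD//; exact: arc_grad_bound.
Qed.

(** A curve from [x] of length less than [u x / L] lowers [u] by less than [u x], so [u] is nonzero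
    at its end. *)
Lemma grad_bound_geodesic_ball x (L : R) (A : set M) : grad_bound u L -> 0 < L ->
  0 < u x -> (forall x', u x' != 0 -> A x') -> geodesic_ball g x (u x / L) `<=` A.
Proof.
move=> uL L0 ux0 uA x' /geodesic_ballP[e xex' eL]; apply: uA; apply/eqP => ux'.
have := curve_grad_bound uL L0 xex'; rewrite ux' subr0 leNgt => /negP; apply.
by rewrite muleC -lte_pdivlMr.
Qed.

End GradientNorm.
End GradientBound.

(** * The bump function supported in a chart *)

Section TestFunction.
Context {R : realType} {n : nat} {M : ptopologicalType}.
Variable g : riemannian_manifold R n M.
Set Implicit Arguments.
Unset Strict Implicit.
Implicit Types (i k : chart_index g) (c y z w : 'rV[R]_n) (x : M) (u : M -> R).

Lemma open_param_preimage k (A : set M) : open A ->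
  open (image k `&` param k @^-1` A).
Proof.
move=> oA; rewrite openE => y [ky Ay]; apply: filterI; first exact: near_image.
have pc : {for y, continuous (param k)} := param_continuous ky.
by apply: pc; exact: open_nbhs_nbhs.
Qed.

Lemma image_overlap k i :
  chart k @` (cdom k `&` cdom i) = image k `&` param k @^-1` cdom i.
Proof.
apply/seteqP; split => y.
  by move=> [x [kx ix] <-]; split; [exact: image_chart|rewrite /= chartK].
by move=> [[x kx <-]]; rewrite /= chartK// => ix; exists x.
Qed.

(** For [F] a transition map, this is the profile of the bump read in another chart. *)
Lemma smooth_on_squares (V : set 'rV[R]_n) (F : 'rV[R]_n -> 'rV[R]_n)
    c (rho : R) : open V -> smooth_on V F ->
  smooth_on V (fun y => 1 + \sum_j (- ((F y 0 j - c 0 j) / rho) ^+ 2)).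
Proof.
move=> oV sF; apply: smooth_term_smooth => //.
apply: (@SmoothAdd _ _ _ (fun=> 1)); first exact/SmoothBase/smooth_on_cst.
apply: SmoothBase; apply: smooth_on_sum => // j.
apply: (@smooth_on_eq _ _ _ _ oV (fun y =>
    - rho ^- 2 * ((F y 0 j + - c 0 j) * (F y 0 j + - c 0 j)))).
  by move=> y _; rewrite expr_div_n expr2; ring.
apply: smooth_term_smooth => //.
apply: (@SmoothMul _ _ _ (fun=> _)); first exact/SmoothBase/smooth_on_cst.
have sFc : smooth_term V (fun y => F y 0 j + - c 0 j).
  apply: (@SmoothAdd _ _ _ _ (fun=> _)).
    by apply: SmoothBase; exact: smooth_on_coord.
  exact/SmoothBase/smooth_on_cst.
exact: SmoothMul.
Qed.

(** Each of the [n] squares contributes at most [2 / rho] times the norm of ['D_w F y], because its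
    coordinate of [F y - c] is at most [rho]. *)
Lemma derive_squares_le (F : 'rV[R]_n -> 'rV[R]_n) c (rho : R) y w :
  0 < rho -> differentiable F y -> `|F y - c| <= rho ->
  `|'D_w (fun y => 1 + \sum_j (- ((F y 0 j - c 0 j) / rho) ^+ 2)) y| <=
  2 * n%:R / rho * `|'D_w F y|.
Proof.
move=> rho0 dF Fc; pose z : 'rV[R]_n := 'D_w F y.
have dFj j : is_derive y w (fun y => F y 0 j : R) (z 0 j).
  rewrite /z derive_mx ?mxE; last exact: diff_derivable.
  apply: derivableP; apply: diff_derivable.
  exact: (@differentiable_comp _ _ _ _ F (fun w => w 0 j : R)
    y dF (differentiable_coord _ _ _)).
pose G j : 'rV[R]_n -> R := fun y => - rho ^- 2 * ((F y 0 j - c 0 j) * (F y 0 j - c 0 j)).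
have dG j : is_derive y w (G j) (- rho ^- 2 * (2 * (F y 0 j - c 0 j) * z 0 j)).
  have dFc : is_derive y w (fun y => F y 0 j - c 0 j) (z 0 j).
    by have := is_deriveB (dFj j) (is_derive_cst (c 0 j) y w); rewrite subr0.
  have := is_deriveZ (- rho ^- 2) (is_deriveM dFc dFc).
  by rewrite /GRing.scale/= (_ : 2 * _ * _ =
    (F y 0 j - c 0 j) * z 0 j + (F y 0 j - c 0 j) * z 0 j)//; ring.
have -> : (fun y => 1 + \sum_j (- ((F y 0 j - c 0 j) / rho) ^+ 2)) =
    cst (1 : R) + \sum_j G j.
  apply/funext => y'; rewrite fctE fct_sumE; congr (_ + _); apply: eq_bigr => j _.
  by rewrite /G expr_div_n expr2; ring.
have := is_deriveD (is_derive_cst (1 : R) y w) (is_derive_sum dG); rewrite add0r => /@derive_val ->.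
rewrite (le_trans (ler_norm_sum _ _ _))//.
apply: (@le_trans _ _ (\sum_(j < n) 2 / rho * `|z|)); last first.
  by rewrite sumr_const card_ord -mulr_natl le_eqVlt; apply/orP; left; apply/eqP; ring.
apply: ler_sum => j _.
rewrite !normrM normrN normfV normrX (gtr0_norm rho0) (@ger0_norm _ 2)//.
have h1 : `|F y 0 j - c 0 j| <= rho.
  by apply: le_trans Fc; have := norm_coord (F y - c) j; rewrite !mxE.
have h2 : `|z 0 j| <= `|z| := norm_coord z j.
rewrite (_ : 2 / rho * `|z| = rho ^- 2 * (2 * rho * `|z|)); last first.
  by field; rewrite gt_eqF.
rewrite ler_pM2l ?invr_gt0 ?exprn_gt0//.
by rewrite -!mulrA ler_pM2l// ler_pM.
Qed.

Section Bump.
Variables (i : chart_index g) (c : 'rV[R]_n) (rho : R).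

(** A paraboloid for the Euclidean norm, which, unlike the sup norm, has a smooth square. *)
Definition bump_profile y : R := 1 + \sum_j (- ((y 0 j - c 0 j) / rho) ^+ 2).

Definition bump x : R := if `[< cdom i x >] then flat 1 (bump_profile (chart i x)) else 0.

Hypothesis rho0 : 0 < rho.

Lemma bump_profile_gt0 y : 0 < bump_profile y -> `|y - c| < rho.
Proof.
move=> y0; apply: norm_rV_lt => // j; rewrite !mxE.
rewrite -(@ltr_pXn2r _ 2) ?nnegrE ?(ltW rho0)// real_normK ?num_real//.
rewrite -(@ltr_pM2r _ (rho ^- 2)) ?invr_gt0 ?exprn_gt0// divff ?expf_neq0 ?gt_eqF//.
rewrite -expr_div_n.
move: y0; rewrite /bump_profile (bigD1 j)//=.
have : \sum_(k | k != j) - ((y 0 k - c 0 k) / rho) ^+ 2 <= 0.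
  by apply: sumr_le0 => k _; rewrite oppr_le0 sqr_ge0.
lra.
Qed.

(** The [n] squares are each at most [(n + 1) ^- 2], and [n / (n + 1) ^ 2 <= 1 / 2]. *)
Lemma bump_profile_ge y : `|y - c| < rho / n.+1%:R -> 1 / 2 <= bump_profile y.
Proof.
move=> yc; pose N : R := n.+1%:R.
have N0 : 0 < N by rewrite ltr0n.
have : \sum_(j < n) - (N ^- 2) <= \sum_j - ((y 0 j - c 0 j) / rho) ^+ 2.
  apply: ler_sum => j _; rewrite lerN2 -exprVn -real_normK ?num_real//.
  rewrite ler_pXn2r ?nnegrE ?invr_ge0 ?(ltW N0)//.
  rewrite normrM normfV (gtr0_norm rho0) ler_pdivrMr// mulrC.
  by apply: le_trans (ltW yc); have := norm_coord (y - c) j; rewrite !mxE.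
rewrite sumr_const card_ord -[X in X <= _]mulr_natl mulrN.
have : n%:R * N ^- 2 <= 1 / 2.
  rewrite ler_pdivrMr ?exprn_gt0// /N -[n.+1%:R]natr1.
  have : 0 <= (n%:R : R) ^+ 2 by rewrite sqr_ge0.
  by rewrite sqrrD; lra.
rewrite /bump_profile; move: (n%:R * _) (\sum_j _) => q S; lra.
Qed.

Section Controlled.
Variables (s a b m m' : R).
Hypotheses (good : controlled_ball i c s a b m m') (a0 : 0 < a) (rhos : rho < s).

(** As a continuous image of a closed cube it is compact, hence closed in the Hausdorff space [M];
    it contains every point where [bump] is nonzero. *)
Definition bump_support : set M := param i @` [set y | `|y - c| <= rho].

Lemma bump_support_sub : bump_support `<=` chart_ball i c s.
Proof.
move=> x [y yc <-]; have yc' := le_lt_trans yc rhos.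
have iy := cball_image good yc'; split; first exact: cdom_param.
by rewrite paramK.
Qed.

Lemma compact_bump_support : compact bump_support.
Proof.
apply: continuous_compact.
  apply: continuous_in_subspaceT => y; rewrite inE/= => yc.
  exact/param_continuous/(cball_image good)/(le_lt_trans yc rhos).
apply: bounded_closed_compact.
  rewrite /bounded_set; exists (rho + `|c|); split; first exact: num_real.
  move=> t ht y /= yc; apply: le_trans (ltW ht); rewrite -[y](subrK c).
  by apply: le_trans (ler_normD _ _) _; rewrite lerD2r.
rewrite (_ : [set y | _] = closed_ball c rho); first exact: closed_ball_closed.
by rewrite closed_ballE// /closed_ball_; apply/seteqP; split => y /=; rewrite distrC.
Qed.

Lemma closed_bump_support : closed bump_support.
Proof. by apply: compact_closed compact_bump_support; exact: manifold_hausdorff g. Qed.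

Lemma bump_eq0 x : ~ bump_support x -> bump x = 0.
Proof.
move=> nSx; rewrite /bump; case: asboolP => // ix; rewrite flat_le0// leNgt.
apply/negP => /bump_profile_gt0 xc; apply: nSx; exists (chart i x); last exact: chartK.
exact: ltW.
Qed.

Lemma bump_param k y : (chart k @` (cdom k `&` cdom i)) y ->
  (bump \o param k) y = flat 1 (bump_profile ((chart i \o param k) y)).
Proof. by rewrite image_overlap => -[ky iy]; rewrite /= /bump asboolT. Qed.

Lemma open_overlap k : open (chart k @` (cdom k `&` cdom i)).
Proof. rewrite image_overlap; apply: open_param_preimage; exact: cdom_open. Qed.

Lemma overlap_bump_support k y : image k y -> bump_support (param k y) ->
  (chart k @` (cdom k `&` cdom i)) y.
Proof. by move=> ky /bump_support_sub[iy _]; rewrite image_overlap. Qed.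

Lemma near_bump_eq0 x : ~ bump_support x -> \forall x' \near x, bump x' = 0.
Proof.
move=> nSx.
have : nbhs x (~` bump_support).
  by apply: open_nbhs_nbhs; split => //; exact/closed_openC/closed_bump_support.
by apply: filterS => x'; exact: bump_eq0.
Qed.

(** Two open sets cover [M]: the chart domain, where the bump is [flat 1] of a smooth function, and
    the complement of the closed set [bump_support], where it is 0. *)
Lemma bump_smooth : smooth_fun g bump.
Proof.
move=> k; apply: smooth_on_local => y ky.
have [Sy|nSy] := pselect (bump_support (param k y)).
  exists (chart k @` (cdom k `&` cdom i)); first exact: overlap_bump_support.
  have oV := @open_overlap k.
  apply: (@smooth_on_eq _ _ _ _ oV
    (fun y => flat 1 (bump_profile ((chart i \o param k) y)))).
    by move=> y' y'V; rewrite bump_param.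
  apply: smooth_term_smooth => //; apply: SmoothFlat; apply: SmoothBase.
  by apply: smooth_on_squares => //; exact: transition_smooth.
have oV : open (image k `&` param k @^-1` (~` bump_support)).
  exact/open_param_preimage/closed_openC/closed_bump_support.
exists (image k `&` param k @^-1` (~` bump_support)); first by split.
apply: (@smooth_on_eq _ _ _ _ oV (fun=> 0)); last exact: smooth_on_cst.
by move=> y' [_ nS]; rewrite /= bump_eq0.
Qed.

(** [H] bounds the derivative of [flat 1], [derive_squares_le] that of the profile, and [Num.sqrt a]
    converts the coordinate norm into the Riemannian one. *)
Lemma bump_grad_bound (H : R) : (forall t, `|flat ((1 - 1^`()) * 'X^2) t| <= H) ->
  grad_bound g bump (2 * n%:R * H / Num.sqrt a / rho).
Proof.
move=> Hb k y w ky.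
have H0 : 0 <= H := le_trans (normr_ge0 _) (Hb 0).
have [Sy|nSy] := pselect (bump_support (param k y)); last first.
  have -> : 'D_w (bump \o param k) y = 0.
    rewrite (@near_eq_derive _ _ _ _ (cst 0)) ?derive_cst//.
    have pc : {for y, continuous (param k)} := param_continuous ky.
    exact: pc (near_bump_eq0 nSy).
  by rewrite expr0n/= mulr_ge0 ?sqr_ge0//; exact: sqnorm_ge0.
have yV := overlap_bump_support ky Sy.
pose F := chart i \o param k.
have dF : differentiable F y := smooth_on_differentiable (@transition_smooth _ _ _ g k i) yV.
have [iy yc] := bump_support_sub Sy.
have Fc : `|F y - c| <= rho.
  have [y' y'c y'E] := Sy.
  by rewrite /F /= -y'E paramK//; exact/(cball_image good)/(le_lt_trans y'c rhos).
have -> : 'D_w (bump \o param k) y =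
    flat ((1 - 1^`()) * 'X^2) (bump_profile (F y)) * 'D_w (bump_profile \o F) y.
  rewrite (@near_eq_derive _ _ _ _ (fun y => flat 1 ((bump_profile \o F) y))).
    apply: (@derive_flat_comp _ _ _ (bump_profile \o F)).
    apply: smooth_on_differentiable yV; apply: smooth_on_squares.
      exact: open_overlap.
    exact: transition_smooth.
  have := open_nbhs_nbhs (conj (@open_overlap k) yV).
  by apply: filterS => y' y'V; rewrite bump_param.
have := derive_squares_le w rho0 dF Fc; rewrite -/(bump_profile \o F).
set D := 'D_w (bump_profile \o F) y => Dle.
(* The lower bound on the metric is known in the chart [i] only; [metric_change] carries it to the
   chart [k], the transition map sending [w] to ['D_w F y]. *)
have zk : a * `|'D_w F y| ^+ 2 <= sqnorm k y w.
  have [x kx xy] := ky.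
  have xE : param k y = x by rewrite -xy chartK.
  rewrite xE in iy yc.
  apply: le_trans (cball_lower good _ yc) _.
  have mk : metric k y = 'J F y *m metric i (chart i x) *m ('J F y)^T.
    by rewrite -xy; exact: metric_change.
  by rewrite /sqnorm mk deriveEjacobian// trmx_mul !mulmxA.
have Dle' : `|D| * H <= 2 * n%:R * H / rho * `|'D_w F y|.
  rewrite (_ : _ * `|_| = 2 * n%:R / rho * `|'D_w F y| * H); last by ring.
  by rewrite ler_wpM2r.
apply: (@le_trans _ _ ((2 * n%:R * H / rho * `|'D_w F y|) ^+ 2)).
  rewrite -real_normK ?num_real// ler_pXn2r ?nnegrE ?mulr_ge0 ?invr_ge0 ?(ltW rho0)//.
  by apply: le_trans Dle'; rewrite normrM mulrC ler_wpM2l.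
rewrite [leRHS](_ : _ = (2 * n%:R * H / rho) ^+ 2 * (a^-1 * sqnorm k y w)); last first.
  rewrite -{2}(sqr_sqrtr (ltW a0)); have : Num.sqrt a != 0 by rewrite gt_eqF ?sqrtr_gt0.
  by move: (Num.sqrt a) => d d0; field; rewrite d0 gt_eqF.
rewrite exprMn ler_wpM2l ?sqr_ge0//.
by rewrite mulrC ler_pdivlMr// mulrC.
Qed.

Lemma bump_ge x : chart_ball i c (rho / n.+1%:R) x -> flat 1 (1 / 2) <= bump x.
Proof.
move=> [ix xc]; rewrite /bump asboolT//; apply: flat1_mono; exact: bump_profile_ge.
Qed.

End Controlled.
End Bump.
End TestFunction.

(** * Rayleigh quotient of the bump, and uniform constants by compactness *)

Section Eigenvalue.
Context {R : realType} {n : nat} {M : ptopologicalType}.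
Variable g : riemannian_manifold R n M.
Set Implicit Arguments.
Unset Strict Implicit.
Implicit Types (i : chart_index g) (c y z : 'rV[R]_n) (x : M) (u : M -> R).
Implicit Types (mu : {measure set (borel M) -> \bar R}) (Omega : set M).

Lemma lambda1_le mu Omega u (e v : R) : test_function g Omega u ->
  (exists x, u x != 0) -> 0 <= e -> 0 < v ->
  (\int[mu]_(x in Omega) (gradient_sqnorm g u x)%:E <= e%:E)%E ->
  (v%:E <= \int[mu]_(x in Omega) (`|u x| ^+ 2)%:E)%E ->
  (lambda1 g mu Omega <= (e / v)%:E)%E.
Proof.
move=> tu u0 e0 v0 he hv; apply: le_trans (ereal_inf_lbound _) _; first by exists u.
have vinv : (v^-1)%:E = (v%:E^-1)%E :> \bar R by rewrite inver gt_eqF.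
rewrite EFinM vinv; apply: lee_pmul => //.
- by apply: integral_ge0 => x _; rewrite lee_fin gradient_sqnorm_ge0.
- by rewrite inve_ge0 (le_trans _ hv)// lee_fin ltW.
- rewrite lee_pV2// inE; first by rewrite (le_trans _ hv)// lee_fin ltW.
  by rewrite lee_fin ltW.
Qed.

Lemma lambda1_controlled_ball i c (s a b m m' rho H : R) mu Omega :
  controlled_ball i c s a b m m' -> 0 < a -> 0 < m -> 0 < rho -> 2 * rho <= s ->
  (forall t, `|flat ((1 - 1^`()) * 'X^2) t| <= H) ->
  is_riemannian_volume g mu -> open Omega -> chart_ball i c (2 * rho) `<=` Omega ->
  (lambda1 g mu Omega <=
   ((2 * n%:R * H / Num.sqrt a) ^+ 2 * (m' * 2 ^+ n) /
    (flat 1 (1 / 2) ^+ 2 * (m * n.+1%:R ^- n)) / rho ^+ 2)%:E)%E.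
Proof.
move=> good a0 m0 rho0 rhos Hb vol oOmega ballOmega.
have rho2 : rho < 2 * rho by lra.
have rhos' : rho < s by lra.
have good2 : controlled_ball i c (2 * rho) a b m m'.
  by apply: controlled_ball_sub good _; rewrite subrr normr0 add0r.
pose u := bump i c rho.
have S0 x : ~ chart_ball i c (2 * rho) x -> ~ bump_support i c rho x.
  by move=> nx /(bump_support_sub good2 rho2).
have uS : closure [set x | u x != 0] `<=` bump_support i c rho.
  have /closure_id -> := closed_bump_support rho0 good rhos'.
  apply: closure_subset => x /= /eqP ux; apply: contrapT => /(bump_eq0 rho0) ux0.
  exact: ux.
have tu : test_function g Omega u.
  split.
  - exact: (bump_smooth rho0 good rhos').
  - apply: (subclosed_compact _ (compact_bump_support rho0 good rhos') uS).
    exact: closed_closure.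
  - by move=> x /uS /(bump_support_sub good2 rho2) /ballOmega.
have n1 : 0 < n.+1%:R^-1 :> R by rewrite invr_gt0.
have n1' : n.+1%:R^-1 <= 1 :> R by rewrite invf_le1// ler1n.
have t0 : 0 < rho / n.+1%:R by rewrite divr_gt0.
have tr : rho / n.+1%:R <= rho by rewrite ler_piMr// ltW.
have k0 : 0 < flat 1 (1 / 2) :> R by rewrite flat1_gt0.
have ub x : chart_ball i c (rho / n.+1%:R) x -> flat 1 (1 / 2) <= u x.
  exact: (bump_ge rho0).
have m'0 : 0 <= m'.
  have /andP[_] : m <= Num.sqrt (\det (metric i c)) <= m'.
    by apply: (cball_density good); rewrite subrr normr0; lra.
  by apply: le_trans; exact: sqrtr_ge0.
set L := 2 * n%:R * H / Num.sqrt a.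
(* Energy bound over mass bound: the factors [rho ^+ n] of the two volumes cancel. *)
have -> : L ^+ 2 * (m' * 2 ^+ n) / (flat 1 (1 / 2) ^+ 2 * (m * n.+1%:R ^- n)) / rho ^+ 2
    = ((L / rho) ^+ 2 * (m' * (2 * (2 * rho)) ^+ n)) /
      (flat 1 (1 / 2) ^+ 2 * (m * (2 * (rho / n.+1%:R)) ^+ n)).
  rewrite !exprMn !exprVn.
  have : 2 ^+ n != 0 :> R by rewrite expf_neq0.
  have : rho ^+ n != 0 by rewrite expf_neq0 ?gt_eqF.
  have : n.+1%:R ^+ n != 0 :> R by rewrite expf_neq0.
  move: (2 ^+ n) (rho ^+ n) (n.+1%:R ^+ n) => d1 d2 d3 h1 h2 h3.
  by field; rewrite h1 h2 h3 !gt_eqF ?sqrtr_gt0.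
apply: (@lambda1_le _ _ u) => //.
- exists (param i c); apply/lt0r_neq0/(lt_le_trans k0)/ub.
  have ic : image i c by apply: (cball_image good); rewrite subrr normr0; lra.
  by split; [exact: cdom_param|rewrite paramK// subrr normr0].
- by rewrite mulr_ge0 ?sqr_ge0// mulr_ge0// exprn_ge0//; lra.
- by rewrite mulr_gt0 ?exprn_gt0// mulr_gt0// exprn_gt0// mulr_gt0.
(* Energy: the squared gradient is at most [(L / rho) ^+ 2] on [A] and 0 off [A]. *)
- pose A : set (borel M) := chart_ball i c (2 * rho).
  have mA : measurable A := measurable_open (open_chart_ball _ _ _).
  have mO : measurable (Omega : set (borel M)) by exact: measurable_open.
  have su := bump_smooth rho0 good rhos'.
  apply: (@le_trans _ _ (\int[mu]_(x in Omega) ((cst ((L / rho) ^+ 2)%:E) \_ A) x)%E).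
    apply: ge0_le_integral_nonmeasurable => x _.
      by rewrite lee_fin gradient_sqnorm_ge0.
    rewrite patchE; case: ifPn => [_|]; last rewrite notin_setE => Ax.
      rewrite lee_fin; apply: gradient_sqnorm_le => //.
      exact: (bump_grad_bound rho0 good a0 rhos' Hb).
    rewrite lee_fin (gradient_sqnorm_eq0 su (d := 0))//.
    exact: (near_bump_eq0 rho0 good rhos' (S0 _ Ax)).
  rewrite -integral_mkcondr setIidr// integral_cst// [leRHS]EFinM.
  apply: lee_wpmul2l; first by rewrite lee_fin sqr_ge0.
  by apply: (chart_ball_volume_le vol good); rewrite ?mulr_gt0.
(* Mass: only the inner ball, where [u] is at least [flat 1 (1 / 2)], is counted. *)
- pose A : set (borel M) := chart_ball i c (rho / n.+1%:R).
  have mA : measurable A := measurable_open (open_chart_ball _ _ _).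
  have AO : A `<=` Omega.
    move=> x [ix xt]; apply: ballOmega; split => //; exact: lt_trans xt (le_lt_trans tr rho2).
  apply: (@le_trans _ _ (\int[mu]_(x in Omega) ((cst (flat 1 (1 / 2) ^+ 2)%:E) \_ A) x)%E).
    rewrite -integral_mkcondr setIidr// integral_cst// [leLHS]EFinM.
    apply: lee_wpmul2l; first by rewrite lee_fin sqr_ge0.
    by apply: (chart_ball_volume_ge vol good) (le_trans tr (ltW rhos')) => //; exact: ltW.
  apply: ge0_le_integral_nonmeasurable => x _.
    by rewrite patchE; case: ifPn => // _; rewrite lee_fin sqr_ge0.
  rewrite patchE; case: ifPn => [|_]; last by rewrite lee_fin sqr_ge0.
  rewrite inE => /ub ux; rewrite lee_fin ler_pXn2r ?nnegrE ?(ltW k0)//.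
  exact: le_trans ux (ler_norm _).
Qed.

(** By monotonicity a constant good near [p] stays good for all larger ones, that is, near [+oo];
    compactness, as a near-covering property, makes this uniform over [M]. *)
Lemma near_compact_uniform (Q : M -> R -> Prop) : compact [set: M] ->
  (forall x C C', C <= C' -> Q x C -> Q x C') ->
  (forall p : M, exists C, \forall x \near p, Q x C) ->
  exists2 C, 1 <= C & forall x, Q x C.
Proof.
move=> /compact_near_coveringP cM Qmono Qloc.
have : \forall C \near +oo, [set: M] `<=` Q^~ C.
  apply: (cM R (+oo : set_system R) (fun C x => Q x C)) => p _.
  have [C UC] := Qloc p.
  exists ([set x | Q x C], [set C' | C <= C']) => /=.
    by split => //; apply: nbhs_pinfty_ge; exact: num_real.
  by move=> [x C'] [/= QxC CC']; exact: Qmono QxC.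
move=> h; have h1 : \forall C \near +oo, (1 : R) <= C by apply: nbhs_pinfty_ge.
near (+oo : set_system R) => C; exists C; first by near: C.
by move=> x; apply: (near h C).
Unshelve. all: by end_near. Qed.

End Eigenvalue.

(** * Small geodesic balls, bounded distances, and the case of a clopen domain *)

Section Global.
Context {R : realType} {n : nat} {M : ptopologicalType}.
Variable g : riemannian_manifold R n M.
Set Implicit Arguments.
Unset Strict Implicit.
Implicit Types (i : chart_index g) (c y z : 'rV[R]_n) (x p : M) (u : M -> R).
Implicit Types (mu : {measure set (borel M) -> \bar R}) (Omega : set M).

Lemma near_chart_ball i x (t : R) : cdom i x -> 0 < t ->
  \forall x' \near x, chart_ball i (chart i x) t x'.
Proof.
move=> ix t0; apply: open_nbhs_nbhs; split; first exact: open_chart_ball.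
by split; rewrite // subrr normr0.
Qed.

Lemma lambda1_geodesic_ball : compact [set: M] ->
  exists2 C, 1 <= C & forall x (r : R), 0 < r <= C^-1 ->
    forall mu, is_riemannian_volume g mu ->
    forall Omega, open Omega -> geodesic_ball g x r `<=` Omega ->
    (lambda1 g mu Omega <= (C / r ^+ 2)%:E)%E.
Proof.
move=> cM.
have [H _ Hb] := flat_bounded ((1 - 1^`()) * 'X^2 : {poly R}).
(* Positivity is included so that enlarging [C] shrinks the range [r <= C^-1]. *)
pose Q x (C : R) := 0 < C /\ forall r : R, 0 < r <= C^-1 ->
    forall mu, is_riemannian_volume g mu ->
    forall Omega, open Omega -> geodesic_ball g x r `<=` Omega ->
    (lambda1 g mu Omega <= (C / r ^+ 2)%:E)%E.
suff [C C1 h] : exists2 C, 1 <= C & forall x, Q x C.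
  by exists C => // x r hr; apply: (h x).2.
apply: near_compact_uniform => // [x C C' CC' [C0 h]|p].
  have C'0 := lt_le_trans C0 CC'; split => // r /andP[r0 rC'] mu vol Omega oO rO.
  apply: (@le_trans _ _ (C / r ^+ 2)%:E).
    by apply: h => //; rewrite r0 (le_trans rC')// lef_pV2 ?posrE.
  by rewrite lee_fin ler_wpM2r// invr_ge0 exprn_ge0// ltW.
have [i ip] := cdom_cover g p.
have [s [a [b [m [m' [s0 a0 b0 m0 good]]]]]] := controlled_ball_at (image_chart ip).
pose K := (2 * n%:R * H / Num.sqrt a) ^+ 2 * (m' * 2 ^+ n) /
    (flat 1 (1 / 2) ^+ 2 * (m * n.+1%:R ^- n)).
have sb0 : 0 < Num.sqrt b by rewrite sqrtr_gt0.
(* With [rho = r / Num.sqrt b / 2] below, [K / rho ^ 2] is [4 * b * K / r ^ 2]; the second entry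
   makes [r <= C^-1] imply [2 * rho <= s / 2]. *)
pose C := Num.max (4 * b * K) (2 / (s * Num.sqrt b)).
exists C.
have s20 : 0 < s / 2 by rewrite divr_gt0.
apply: filterS (near_chart_ball ip s20) => x [ix xs].
have C0 : 0 < C by rewrite /C lt_max [X in _ || X]divr_gt0 ?orbT// mulr_gt0.
split => // r /andP[r0 rC] mu vol Omega oO rO.
have goodx : controlled_ball i (chart i x) (s / 2) a b m m'.
  by apply: controlled_ball_sub good _; lra.
pose rho := r / Num.sqrt b / 2.
have rho0 : 0 < rho by rewrite !divr_gt0.
have rho2 : 2 * rho = r / Num.sqrt b by rewrite /rho mulrCA divff// mulr1.
have rhos : 2 * rho <= s / 2.
  rewrite rho2 ler_pdivrMr//.
  apply: le_trans rC _; rewrite -[leRHS]invrK lef_pV2 ?posrE//; last first.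
    by rewrite invr_gt0 mulr_gt0.
  by rewrite /C le_max; apply/orP; right; rewrite -[X in _ <= X]invf_div mulrAC.
have sub : chart_ball i (chart i x) (2 * rho) `<=` Omega.
  apply: subset_trans rO; rewrite -[X in geodesic_ball _ X](chartK ix).
  apply: (chart_ball_sub_geodesic_ball goodx) => //.
  by rewrite rho2 mulrC divfK ?gt_eqF.
have := lambda1_controlled_ball goodx a0 m0 rho0 rhos Hb vol oO sub.
move=> /le_trans; apply; rewrite lee_fin -/K.
rewrite (_ : K / rho ^+ 2 = 4 * b * K / r ^+ 2); last first.
  rewrite /rho !exprMn !exprVn sqr_sqrtr ?(ltW b0)//; field.
  by rewrite !gt_eqF.
by rewrite ler_wpM2r ?invr_ge0 ?exprn_ge0 ?(ltW r0)// /C le_max lexx.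
Qed.

Lemma near_geodesic_ball p :
  exists2 D : R, 0 < D & exists2 U : set M, nbhs p U &
    forall x x', U x -> U x' -> geodesic_ball g x D x'.
Proof.
have [i ip] := cdom_cover g p.
have [s [a [b [m [m' [s0 a0 b0 m0 good]]]]]] := controlled_ball_at (image_chart ip).
have sb0 : 0 < Num.sqrt b by rewrite sqrtr_gt0.
exists (Num.sqrt b * (2 * s)); first by rewrite !mulr_gt0.
exists (chart_ball i (chart i p) s); first exact: near_chart_ball.
move=> x x' [ix xs] [ix' x's]; rewrite -(chartK ix) -(chartK ix').
apply: (segment_geodesic_ball good) => //; rewrite ltr_pM2l//.
have := ler_normB (chart i x' - chart i p) (chart i x - chart i p).
by rewrite opprB addrA subrK => /le_lt_trans; apply; lra.
Qed.

(** Compactness is used twice: for the end [x'] with [x] fixed, then for [x], each time moving the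
    varying point to the centre of a neighbourhood from [near_geodesic_ball]. *)
Lemma geodesic_ball_bounded : compact [set: M] ->
  exists2 D : R, 1 <= D & forall x x' (r : R),
    geodesic_ball g x r x' -> geodesic_ball g x D x'.
Proof.
move=> cM.
have h1 x : exists2 D : R, 1 <= D & forall x' (r : R),
    geodesic_ball g x r x' -> geodesic_ball g x D x'.
  apply: (near_compact_uniform (Q := fun x' D => forall r : R,
    geodesic_ball g x r x' -> geodesic_ball g x D x')) => //.
    by move=> x' C C' CC' h r /h; exact: geodesic_ball_le.
  move=> p; have [D D0 [U pU UD]] := near_geodesic_ball p.
  have Up := nbhs_singleton pU.
  have [[r0 xr0]|nr] := pselect (exists r0 : R, geodesic_ball g x r0 p).
    exists (r0 + D); apply: filterS pU => x' Ux' r _.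
    exact: geodesic_ball_trans xr0 (UD _ _ Up Ux').
  (* Here no point of [U] is at finite distance from [x], so any constant serves. *)
  exists 0; apply: filterS pU => x' Ux' r xr; exfalso; apply: nr.
  by exists (r + D); exact: geodesic_ball_trans xr (UD _ _ Ux' Up).
suff [D D1 h] : exists2 D : R, 1 <= D & forall x,
    forall x' (r : R), geodesic_ball g x r x' -> geodesic_ball g x D x'.
  by exists D.
apply: (near_compact_uniform (Q := fun x D => forall x' (r : R),
    geodesic_ball g x r x' -> geodesic_ball g x D x')) => //.
  by move=> x C C' CC' h x' r /h; exact: geodesic_ball_le.
move=> p; have [D D0 [U pU UD]] := near_geodesic_ball p.
have Up := nbhs_singleton pU; have [Dp _ hp] := h1 p.
exists (D + Dp); apply: filterS pU => x Ux x' r xr.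
apply: (geodesic_ball_trans (UD _ _ Ux Up)).
exact: hp (geodesic_ball_trans (UD _ _ Up Ux) xr).
Qed.

Lemma open_geodesic_ball_sub Omega x : open Omega -> Omega x ->
  exists2 r : R, 0 < r & geodesic_ball g x r `<=` Omega.
Proof.
move=> oO Ox.
have [i ix] := cdom_cover g x.
have ic := image_chart ix.
have [s [a [b [m [m' [s0 a0 b0 m0 good]]]]]] := controlled_ball_at ic.
have [H _ Hb] := flat_bounded ((1 - 1^`()) * 'X^2 : {poly R}).
have pc : {for chart i x, continuous (param i)} := param_continuous ic.
have : nbhs (chart i x) (param i @^-1` Omega).
  by apply: pc; rewrite chartK//; exact: open_nbhs_nbhs.
move=> /nbhs_ballP[e /= e0 eO].
(* On the cube of radius [t] the metric is controlled and [param i] has values in [Omega]. *)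
pose t := Num.min s e; have t0 : 0 < t by rewrite lt_min s0.
pose rho := t / 2; have rho0 : 0 < rho by rewrite divr_gt0.
have rhos : rho < t by rewrite /rho; lra.
have goodt : controlled_ball i (chart i x) t a b m m'.
  by apply: controlled_ball_sub good _; rewrite subrr normr0 add0r ge_min lexx.
pose u := bump i (chart i x) rho.
have ux : 0 < u x.
  apply: (@lt_le_trans _ _ (flat 1 (1 / 2))); first by rewrite flat1_gt0.
  by apply: bump_ge => //; split => //; rewrite subrr normr0 divr_gt0.
pose L := 2 * n%:R * H / Num.sqrt a / rho.
have H0 : 0 <= H := le_trans (normr_ge0 _) (Hb 0).
have L0 : 0 <= L.
  by rewrite /L !mulr_ge0// invr_ge0 ?sqrtr_ge0// ltW.
(* [L] is 0 when [n = 0], and the radius below is a quotient by a positive bound. *)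
have L1 : 0 < L + 1 by rewrite ltr_wpDl.
have su : smooth_fun g u := bump_smooth rho0 goodt rhos.
exists (u x / (L + 1)); first by rewrite divr_gt0.
apply: (grad_bound_geodesic_ball su _ L1 ux).
  apply: (grad_bound_le L0 _ (bump_grad_bound rho0 goodt a0 rhos Hb)).
  by rewrite lerDl.
move=> x' ux'; apply: contrapT => nO.
move/eqP: ux'; apply; apply: (bump_eq0 rho0) => /(bump_support_sub goodt rhos)[ix' x't].
apply: nO; rewrite -(chartK ix'); apply: eO; rewrite -ball_normE/= distrC.
by apply: lt_le_trans x't _; rewrite ge_min lexx orbT.
Qed.

(** The indicator of a clopen set is locally constant, hence smooth with zero gradient, and its
    support is closed in the compact space [M]. *)
Lemma lambda1_clopen mu Omega : compact [set: M] -> open Omega -> closed Omega ->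
  Omega !=set0 -> (lambda1 g mu Omega <= 0)%E.
Proof.
move=> cM oO cO [x0 Ox0].
pose u x : R := \1_Omega x.
have u1 x : Omega x -> u x = 1 by move=> Ox; rewrite /u indicE mem_set.
have u0 x : ~ Omega x -> u x = 0 by move=> Ox; rewrite /u indicE memNset.
have su : smooth_fun g u.
  move=> i; apply: smooth_on_local => y iy.
  have [Oy|nOy] := pselect (Omega (param i y)).
    have oV := open_param_preimage (k := i) oO.
    exists (image i `&` param i @^-1` Omega); first by split.
    apply: (@smooth_on_eq _ _ _ _ oV (fun=> (1 : R))); last exact: smooth_on_cst.
    by move=> y' [_ /u1].
  have oV := open_param_preimage (k := i) (closed_openC cO).
  exists (image i `&` param i @^-1` (~` Omega)); first by split.
  apply: (@smooth_on_eq _ _ _ _ oV (fun=> (0 : R))); last exact: smooth_on_cst.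
  by move=> y' [_ /u0].
have uO : closure [set x | u x != 0] `<=` Omega.
  have /closure_id -> := cO.
  by apply: closure_subset => x /= /eqP ux; apply: contrapT => /u0.
apply: le_trans (ereal_inf_lbound _) _.
  exists u; last by []; split; last by exists x0; rewrite u1// oner_neq0.
  split => //; apply: (subclosed_compact _ cM) => //; exact: closed_closure.
rewrite integral0_eq ?mul0e// => x Ox.
rewrite (gradient_sqnorm_eq0 su (d := 1))//.
have : nbhs x Omega by exact: open_nbhs_nbhs.
by apply: filterS => x' /u1.
Qed.

(** By the choice of [D] the ball is the set of all points at finite distance from [x]. Neighbouring
    points are at finite distance from each other, so the ball and its complement are open. *)
Lemma geodesic_ball_sub_lambda1 mu Omega x (D : R) : compact [set: M] -> domain Omega ->
  (forall x x' (r : R), geodesic_ball g x r x' -> geodesic_ball g x D x') ->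
  0 < D -> geodesic_ball g x D `<=` Omega -> (lambda1 g mu Omega <= 0)%E.
Proof.
move=> cM [oO conO _] Dmax D0 DO.
have xD : geodesic_ball g x D x by exact: geodesic_ball_center.
have oB : open (geodesic_ball g x D).
  rewrite openE => x' x'D; have [d d0 [U Ux' Ud]] := near_geodesic_ball x'.
  apply: (filterS _ Ux') => z Uz; apply: Dmax.
  exact: geodesic_ball_trans x'D (Ud _ _ (nbhs_singleton Ux') Uz).
have cB : closed (geodesic_ball g x D).
  rewrite -openC openE => x' x'D; have [d d0 [U Ux' Ud]] := near_geodesic_ball x'.
  apply: (filterS _ Ux') => z Uz zD; apply: x'D; apply: Dmax.
  exact: geodesic_ball_trans zD (Ud _ _ Uz (nbhs_singleton Ux')).
have BO : geodesic_ball g x D = Omega.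
  apply: conO; first by exists x.
  - by exists (geodesic_ball g x D) => //; rewrite setIidr.
  - by exists (geodesic_ball g x D) => //; rewrite setIidr.
by rewrite -BO; apply: lambda1_clopen => //; exists x.
Qed.

End Global.

(** * From geodesic balls to the inner radius *)

Theorem theorem3 (R : realType) (n : nat) (M : ptopologicalType)
    (g : riemannian_manifold R n M) (closedM : compact [set: M]) :
  exists C5 : R, 0 < C5 /\
    forall mu : {measure set (borel M) -> \bar R}, is_riemannian_volume g mu ->
    forall Omega : set M, domain Omega ->
      (lambda1 g mu Omega <= C5%:E / (inrad g Omega) ^+ 2)%E.
Proof.
have [C C1 hC] := lambda1_geodesic_ball g closedM.
have [D D1 hD] := geodesic_ball_bounded g closedM.
have C0 : 0 < C := lt_le_trans ltr01 C1.
have D0 : 0 < D := lt_le_trans ltr01 D1.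
(* The 4 pays for a ball of radius only above [inrad / 2], and [(D * C) ^+ 2] for shrinking it by
   [D * C]. *)
exists (4 * C * (D * C) ^+ 2); split.
  by rewrite !mulr_gt0// exprn_gt0// mulr_gt0.
move=> mu vol Omega dO.
have [[x xD]|noD] := pselect (exists x, geodesic_ball g x D `<=` Omega).
  apply: (@le_trans _ _ 0%E); first exact: geodesic_ball_sub_lambda1 xD.
  (* The right-hand side is nonnegative, including when [inrad] is infinite. *)
  apply: mule_ge0; first by rewrite lee_fin !mulr_ge0 ?sqr_ge0// ltW.
  by rewrite inve_ge0 sqre_ge0.
have [oO _ [x0 Ox0]] := dO.
have S_le r : 0 < r -> (exists x, geodesic_ball g x r `<=` Omega) -> r <= D.
  move=> r0 [x xr]; rewrite leNgt; apply/negP => Dr; apply: noD; exists x.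
  by apply: subset_trans xr; apply: geodesic_ball_le; exact: ltW.
have [r0 r00 r0O] := open_geodesic_ball_sub g oO Ox0.
have inrad_gt0 : (0 < inrad g Omega)%E.
  apply: (@lt_le_trans _ _ r0%:E); first by rewrite lte_fin.
  by apply: ereal_sup_ubound; exists r0 => //; split => //; exists x0.
have inrad_le : (inrad g Omega <= D%:E)%E.
  by apply: ge_ereal_sup => _ [r [r_gt0 xr] <-]; rewrite lee_fin S_le.
have [w wE] : exists w : R, inrad g Omega = w%:E.
  exists (fine (inrad g Omega)); rewrite fineK// ge0_fin_numE; last exact: ltW.
  by apply: le_lt_trans inrad_le _; exact: ltry.
have w0 : 0 < w by rewrite wE lte_fin in inrad_gt0.
(* The supremum need not be attained, but some admissible radius exceeds half of it. *)
have : ((w / 2)%:E < inrad g Omega)%E by rewrite wE lte_fin; lra.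
move=> /ereal_sup_gt[_ [r [r_gt0 [x xr]] <-]]; rewrite lte_fin => wr.
have rD := S_le r r_gt0 (ex_intro _ x xr).
(* Dividing by [D * C] gives [r' <= C^-1] because [r <= D], and [r' <= r] because [D] and [C] are at
   least 1. *)
pose r' := r / (D * C).
have DC0 : 0 < D * C by rewrite mulr_gt0.
have r'0 : 0 < r' by rewrite divr_gt0.
have r'C : r' <= C^-1 by rewrite /r' ler_pdivrMr// mulrC mulfK ?gt_eqF.
have r'r : r' <= r.
  rewrite /r' ler_pdivrMr// ler_peMr ?(ltW r_gt0)//.
  by rewrite -[1]mulr1 ler_pM.
have r'O : geodesic_ball g x r' `<=` Omega.
  by apply: subset_trans xr; exact: geodesic_ball_le.
have := hC x r'; rewrite r'0 r'C => /(_ isT mu vol Omega oO r'O) /le_trans; apply.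
rewrite wE -EFin_expe inver expf_eq0/= gt_eqF// -EFinM lee_fin.
rewrite (_ : C / r' ^+ 2 = C * (D * C) ^+ 2 * r ^- 2); last first.
  by rewrite /r'; field; rewrite !gt_eqF.
rewrite (_ : _ / w ^+ 2 = C * (D * C) ^+ 2 * (w / 2) ^- 2); last first.
  by field; rewrite gt_eqF.
rewrite ler_pM2l ?mulr_gt0 ?exprn_gt0// lef_pV2 ?posrE ?exprn_gt0 ?divr_gt0//.
by rewrite ler_pXn2r ?nnegrE ?divr_ge0 ?(ltW w0) ?(ltW r_gt0)// ltW.
Qed.
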